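(* Let $G$ be a group and $\mathbb{F}$ a field, and consider the set of $G$-graded polynomials $x_1^{(g)}x_2^{(h)}$, for $g,h\in G$ with $[g,h]\ne1$. Let $\mathscr{V}_G$ be the variety of $G$-graded associative algebras satisfying these polynomials as graded identities, and let $\mathscr{W}_G$ be the variety of $G$-graded associative-Lie pairs satisfying these polynomials as weak identities. Let $X_G$ be a set of $G$-graded variables, let $\mathbb{F}_G(X_G)$ be the relatively free algebra in $\mathscr{V}_G$, freely generated by $X_G$, and let $(\mathcal{L},\mathcal{F})$ be a free pair in $\mathscr{W}_G$, freely generated by $X_G$. Then: (i) The Lie subalgebra $\mathcal{L}_G(X_G)$ of $\mathbb{F}_G(X_G)$ (under the commutator) generated by $X_G$ is the free $G$-graded Lie algebra, freely generated by $X_G$. Furthermore, $\mathrm{SU}_G(\mathcal{L}_G(X_G))=\mathbb{F}_G(X_G)$. (ii) The Lie subalgebra of $\mathcal{F}$ generated by $X_G$ coincides with $\mathcal{L}$, and it is the free $G$-graded Lie algebra, freely generated by $X_G$. Moreover, $U_G(\mathcal{L})=\mathcal{F}$.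
   Context: A $G$-grading on an algebra $\mathcal{A}$ (associative or Lie) is a vector space decomposition $\mathcal{A}=\bigoplus_{g\in G}\mathcal{A}_g$ with $\mathcal{A}_g\mathcal{A}_h\subseteq\mathcal{A}_{gh}$ for all $g,h\in G$ (for a Lie algebra the product is the bracket). Graded homomorphisms preserve homogeneous components. $[g,h]$ denotes the group commutator. Associative algebras are unital and their homomorphisms preserve the unit. $X_G=\bigcup_{g\in G}X_g$, where the variables $x_i^{(g)}\in X_g$ have degree $g$. A map from $X_G$ to a graded algebra respects degrees if it sends $X_g$ into the component of degree $g$. A $G$-pair (graded associative-Lie pair) $(\mathcal{L},\mathcal{A})$ is a $G$-graded associative algebra $\mathcal{A}$ together with a $G$-graded subspace $\mathcal{L}\subseteq\mathcal{A}$ closed under the commutator and such that $\mathcal{L}$ with the commutator is a $G$-graded Lie algebra. It is strong if moreover $[\mathcal{A}_g,\mathcal{A}_h]\subseteq\mathcal{A}_{gh}$ for all $g,h$. A homomorphism of pairs $(\mathcal{L},\mathcal{A})\to(\mathcal{H},\mathcal{C})$ is a $G$-graded algebra homomorphism $\mathcal{A}\to\mathcal{C}$ mapping $\mathcal{L}$ into $\mathcal{H}$. $\mathscr{V}_G$: the $G$-graded associative algebras $\mathcal{A}$ with $ab=0$ for all $a\in\mathcal{A}_g$, $b\in\mathcal{A}_h$, $[g,h]\neq1$. $\mathscr{W}_G$: the $G$-pairs $(\mathcal{L},\mathcal{A})$ with $xy=0$ in $\mathcal{A}$ for all $x\in\mathcal{L}_g$, $y\in\mathcal{L}_h$, $[g,h]\ne1$.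 The relatively free algebra $\mathbb{F}_G(X_G)$ is the algebra in $\mathscr{V}_G$ generated by $X_G$ such that every degree-respecting map from $X_G$ to an algebra of $\mathscr{V}_G$ extends uniquely to a $G$-graded homomorphism. A pair $(\mathcal{L},\mathcal{F})$ in $\mathscr{W}_G$ (with $X_G\subseteq\mathcal{L}$ respecting degrees) is free, freely generated by $X_G$, if for every $(\mathcal{H},\mathcal{C})$ in $\mathscr{W}_G$ every degree-respecting map $X_G\to\mathcal{H}$ extends uniquely to a homomorphism of pairs $(\mathcal{L},\mathcal{F})\to(\mathcal{H},\mathcal{C})$. The free $G$-graded Lie algebra freely generated by $X_G$ is the $G$-graded Lie algebra containing $X_G$ such that every degree-respecting map from $X_G$ to a $G$-graded Lie algebra extends uniquely to a $G$-graded Lie homomorphism. The $G$-graded universal enveloping algebra $U_G(\mathcal{L})$ of a $G$-graded Lie algebra $\mathcal{L}$ is the $G$-pair $(\mathcal{L},U_G(\mathcal{L}))$ with $U_G(\mathcal{L})$ generated by $\mathcal{L}$ and such that, for every $G$-pair $(\mathcal{H},\mathcal{A})$, every $G$-graded Lie homomorphism $\mathcal{L}\to\mathcal{H}$ extends to a $G$-graded algebra homomorphism $U_G(\mathcal{L})\to\mathcal{A}$. The strong $G$-graded universal enveloping algebra is the strong pair $(\mathcal{L},\mathrm{SU}_G(\mathcal{L}))$ such that for every strong pair $(\mathcal{H},\mathcal{A})$ every $G$-graded Lie homomorphism $\mathcal{L}\to\mathcal{H}$ extends uniquely to a $G$-graded algebra homomorphism $\mathrm{SU}_G(\mathcal{L})\to\mathcal{A}$.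 Both are unique up to isomorphism; the equalities in the claim mean that $\mathbb{F}_G(X_G)$ and $\mathcal{F}$, with the inclusions of the Lie algebras, have these universal properties. *)

(* Defs.v *)
(* Associative algebras are objects of [algType F], hence unital with 1 != 0.
   Leaving the zero algebra out of the universal properties below loses nothing:
   exactly one map into it exists, and it is a homomorphism. *)
From HB Require Import structures.
From mathcomp Require Import all_boot all_algebra.
From mathcomp Require Import boolp.

Set Implicit Arguments.
Unset Strict Implicit.
Unset Printing Implicit Defensive.

Import GRing.Theory.
Local Open Scope ring_scope.

HB.mixin Record Lmodule_isLie (F : fieldType) L of GRing.Lmodule F L := {
  lie : L -> L -> L;
  lie_linearl : forall y, linear (lie^~ y);
  lie_linearr : forall x, linear (lie x);
  liexx : forall x, lie x x = 0;
  lie_jacobi : forall x y z,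
    lie x (lie y z) + lie y (lie z x) + lie z (lie x y) = 0
}.

#[short(type="lieAlgType")]
HB.structure Definition LieAlgebra (F : fieldType) :=
  { L of Lmodule_isLie F L & GRing.Lmodule F L }.

Definition commr (A : pzRingType) (x y : A) : A := x * y - y * x.

Record lieSubalg (F : fieldType) (A : algType F) := LieSubalg {
  lieSubalg_pred :> {pred A};
  lieSubalg_submod : submod_closed lieSubalg_pred;
  lieSubalg_commr :
    {in lieSubalg_pred &, forall x y, commr x y \in lieSubalg_pred}
}.

Section LieSub.
Variables (F : fieldType) (A : algType F) (L : lieSubalg A).

HB.instance Definition _ := GRing.isSubmodClosed.Build F A
  (lieSubalg_pred L) (lieSubalg_submod L).

(* The carrier of [L] as a type, made a Lie algebra by the commutator. *)
Record lie_sub : predArgType :=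
  LieSub { lie_sub_val : A; _ : lie_sub_val \in lieSubalg_pred L }.

HB.instance Definition _ := [isSub for lie_sub_val].
HB.instance Definition _ := [Choice of lie_sub by <:].
HB.instance Definition _ := [SubChoice_isSubLmodule of lie_sub by <:].

Definition lie_sub_bracket (x y : lie_sub) : lie_sub :=
  LieSub (lieSubalg_commr (valP x) (valP y)).

Fact lie_sub_linearl y : linear (lie_sub_bracket^~ y).
Proof.
move=> a u v; apply: val_inj.
rewrite linearP /= /commr.
by rewrite mulrDl mulrDr -scalerAl -scalerAr scalerBr opprD addrACA.
Qed.

Fact lie_sub_linearr x : linear (lie_sub_bracket x).
Proof.
move=> a u v; apply: val_inj.
rewrite linearP /= /commr.
by rewrite mulrDl mulrDr -scalerAl -scalerAr scalerBr opprD addrACA.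
Qed.

Fact lie_sub_xx x : lie_sub_bracket x x = 0.
Proof. by apply: val_inj; rewrite raddf0 /= /commr subrr. Qed.

Fact lie_sub_jacobi x y z :
  lie_sub_bracket x (lie_sub_bracket y z)
  + lie_sub_bracket y (lie_sub_bracket z x)
  + lie_sub_bracket z (lie_sub_bracket x y) = 0.
Proof.
apply: val_inj; rewrite !raddfD raddf0 /= /commr.
rewrite !(mulrBr, mulrBl) !mulrA !opprB !addrA.
rewrite [LHS](ACl ((1*12)*(7*2)*(3*10)*(5*4)*(11*6)*(9*8)))%AC /=.
by rewrite !subrr !addr0.
Qed.

HB.instance Definition _ := Lmodule_isLie.Build F lie_sub
  lie_sub_linearl lie_sub_linearr lie_sub_xx lie_sub_jacobi.

End LieSub.

Section GeneratedLie.
Variables (F : fieldType) (A : algType F) (X : Type) (i : X -> A).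

Definition lie_gen_pred : {pred A} := fun a =>
  `[< forall L : lieSubalg A, (forall x, i x \in L) -> a \in L >].

Fact lie_gen_submod : submod_closed lie_gen_pred.
Proof.
split=> [|c u v /asboolP Lu /asboolP Lv]; apply/asboolP => L iL.
  by case: (lieSubalg_submod L).
by apply: (lieSubalg_submod L).2; [apply: Lu | apply: Lv].
Qed.

Fact lie_gen_commr :
  {in lie_gen_pred &, forall x y, commr x y \in lie_gen_pred}.
Proof.
move=> u v /asboolP Lu /asboolP Lv; apply/asboolP => L iL.
by apply: lieSubalg_commr; [apply: Lu | apply: Lv].
Qed.

Definition lie_gen : lieSubalg A := LieSubalg lie_gen_submod lie_gen_commr.

Fact lie_gen_mem x : i x \in lieSubalg_pred lie_gen.
Proof. by apply/asboolP => L; apply. Qed.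

Definition lie_gen_in (x : X) : lie_sub lie_gen := LieSub (lie_gen_mem x).

End GeneratedLie.

Definition alg_generated (F : fieldType) (A : algType F) (S : A -> Prop) :=
  forall B : {pred A}, subalg_closed B ->
    (forall a, S a -> a \in B) -> forall a, a \in B.

Section Graded.
Variables (G : groupType) (F : fieldType).

(* [V] is the direct sum of the [V_ g]; finitely supported families are given
   by a function together with a finite list of indices. *)
Definition direct_decomp (V : lmodType F) (V_ : G -> {pred V}) : Prop :=
  [/\ forall g, submod_closed (V_ g),
      forall v, exists (s : seq G) (w : G -> V),
        (forall g, w g \in V_ g) /\ v = \sum_(g <- s) w g
    & forall (s : seq G) (w : G -> V), uniq s ->
        (forall g, w g \in V_ g) -> \sum_(g <- s) w g = 0 ->
        forall g, g \in s -> w g = 0].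

Definition grading (V : lmodType F) (op : V -> V -> V) (V_ : G -> {pred V}) :=
  direct_decomp V_ /\
  forall g h x y, x \in V_ g -> y \in V_ h -> op x y \in V_ (g * h)%g.

Definition alg_grading (A : algType F) (A_ : G -> {pred A}) := grading *%R A_.

Definition lie_grading (L : lieAlgType F) (L_ : G -> {pred L}) := grading lie L_.

Definition graded_map (U V : Type) (U_ : G -> {pred U}) (V_ : G -> {pred V})
    (f : U -> V) : Prop :=
  forall g x, x \in U_ g -> f x \in V_ g.

Definition glie_hom (L H : lieAlgType F)
    (L_ : G -> {pred L}) (H_ : G -> {pred H}) (f : {linear L -> H}) : Prop :=
  (forall x y, f (lie x y) = lie (f x) (f y)) /\ graded_map L_ H_ f.

(* The family L :&: A_g, as subspaces of the type [lie_sub L]. *)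
Definition sub_gr (A : algType F) (A_ : G -> {pred A}) (L : lieSubalg A)
    (g : G) : {pred lie_sub L} := fun x => val x \in A_ g.

(* That [sub_gr A_ L] is a decomposition of [L] says that [L] is a graded
   subspace of [A]. *)
Definition gpair (A : algType F) (A_ : G -> {pred A}) (L : lieSubalg A) :=
  alg_grading A_ /\ lie_grading (sub_gr A_ (L := L)).

Definition strong_gpair (A : algType F) (A_ : G -> {pred A})
    (L : lieSubalg A) :=
  gpair A_ L /\
  forall g h a b, a \in A_ g -> b \in A_ h -> commr a b \in A_ (g * h)%g.

Definition pair_hom (A C : algType F) (A_ : G -> {pred A}) (C_ : G -> {pred C})
    (L : lieSubalg A) (H : lieSubalg C) (f : {lrmorphism A -> C}) : Prop :=
  graded_map A_ C_ f /\ forall a, a \in L -> f a \in H.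

Definition in_VG (A : algType F) (A_ : G -> {pred A}) : Prop :=
  alg_grading A_ /\
  forall g h a b, [~ g, h]%g != 1%g -> a \in A_ g -> b \in A_ h -> a * b = 0.

Definition in_WG (A : algType F) (A_ : G -> {pred A}) (L : lieSubalg A) :=
  gpair A_ L /\
  forall g h (x y : lie_sub L), [~ g, h]%g != 1%g ->
    x \in sub_gr A_ g -> y \in sub_gr A_ h -> val x * val y = 0.

(* The homogeneous variables are the elements of [X], and [X_g] is the fibre of
   [deg] over [g]. *)
Definition respects (X : Type) (deg : X -> G) (V : Type) (V_ : G -> {pred V})
    (u : X -> V) : Prop :=
  forall x, u x \in V_ (deg x).

Definition relfree_VG (X : Type) (deg : X -> G) (A : algType F)
    (A_ : G -> {pred A}) (i : X -> A) : Prop :=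
  [/\ in_VG A_, injective i, respects deg A_ i,
      alg_generated (fun a => exists x, a = i x)
    & forall (C : algType F) (C_ : G -> {pred C}), in_VG C_ ->
      forall u : X -> C, respects deg C_ u ->
      exists2 f : {lrmorphism A -> C},
        graded_map A_ C_ f /\ (forall x, f (i x) = u x)
      & forall f' : {lrmorphism A -> C},
        graded_map A_ C_ f' /\ (forall x, f' (i x) = u x) -> f' =1 f].

Definition free_WG (X : Type) (deg : X -> G) (A : algType F)
    (A_ : G -> {pred A}) (L : lieSubalg A) (i : X -> lie_sub L) : Prop :=
  [/\ in_WG A_ L, injective i, respects deg (sub_gr A_ (L := L)) i
    & forall (C : algType F) (C_ : G -> {pred C}) (H : lieSubalg C),
      in_WG C_ H ->
      forall u : X -> lie_sub H, respects deg (sub_gr C_ (L := H)) u ->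
      exists2 f : {lrmorphism A -> C},
        pair_hom A_ C_ L H f /\ (forall x, f (val (i x)) = val (u x))
      & forall f' : {lrmorphism A -> C},
        pair_hom A_ C_ L H f' /\ (forall x, f' (val (i x)) = val (u x)) ->
        f' =1 f].

Definition free_glie (X : Type) (deg : X -> G) (L : lieAlgType F)
    (L_ : G -> {pred L}) (i : X -> L) : Prop :=
  [/\ lie_grading L_, injective i, respects deg L_ i
    & forall (H : lieAlgType F) (H_ : G -> {pred H}), lie_grading H_ ->
      forall u : X -> H, respects deg H_ u ->
      exists2 f : {linear L -> H},
        glie_hom L_ H_ f /\ (forall x, f (i x) = u x)
      & forall f' : {linear L -> H},
        glie_hom L_ H_ f' /\ (forall x, f' (i x) = u x) -> f' =1 f].

(* Only the existence of the extension is required; its uniqueness follows from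
   generation by [L]. *)
Definition is_UG (A : algType F) (A_ : G -> {pred A}) (L : lieSubalg A) :=
  [/\ gpair A_ L, alg_generated (fun a => a \in L)
    & forall (C : algType F) (C_ : G -> {pred C}) (H : lieSubalg C),
      gpair C_ H ->
      forall phi : {linear lie_sub L -> lie_sub H},
      glie_hom (sub_gr A_ (L := L)) (sub_gr C_ (L := H)) phi ->
      exists f : {lrmorphism A -> C},
        graded_map A_ C_ f /\ (forall x, f (val x) = val (phi x))].

Definition is_SUG (A : algType F) (A_ : G -> {pred A}) (L : lieSubalg A) :=
  strong_gpair A_ L /\
  forall (C : algType F) (C_ : G -> {pred C}) (H : lieSubalg C),
    strong_gpair C_ H ->
    forall phi : {linear lie_sub L -> lie_sub H},
    glie_hom (sub_gr A_ (L := L)) (sub_gr C_ (L := H)) phi ->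
    exists2 f : {lrmorphism A -> C},
      graded_map A_ C_ f /\ (forall x, f (val x) = val (phi x))
    & forall f' : {lrmorphism A -> C},
      graded_map A_ C_ f' /\ (forall x, f' (val x) = val (phi x)) -> f' =1 f.

End Graded.

(* Main.v *)
Require Import Defs.
From HB Require Import structures.
From mathcomp Require Import all_boot all_algebra.
From mathcomp Require Import boolp functions.

Set Implicit Arguments.
Unset Strict Implicit.
Unset Printing Implicit Defensive.

Import GRing.Theory.
Local Open Scope ring_scope.

(** Everything rests on one transfer principle, [graded_lie_identityP]: if every
    degree-respecting map from the generators of an algebra [A] into an algebra
    of the variety V_G extends to a homomorphism on [A], then a Lie polynomial
    in the generators that vanishes in [A] vanishes in every [G]-graded Lie
    algebra [H]. Freeness
    of the Lie algebra generated inside [A] is then immediate: send the value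
    of a Lie polynomial in [A] to its value in [H]. So the point is to show
    that V_G has enough algebras to detect every non-identity of graded Lie
    algebras.

    Without gradings this says that the free Lie algebra embeds in the free
    associative algebra ([lie_identity_of_assoc]), over any field. It is proved
    by eliminating one letter [y] at a time (Lazard): modulo a multiple of [y],
    a Lie polynomial [t] is a Lie polynomial [t'] in the letters
    [x_k = ad(y)^k x]. If [t] vanishes in all associative algebras then so does
    [t']: any choice of elements [c_(x,k)] of an algebra [C] in place of the
    [x_k] comes, up to a constant term, from letting [y] act on divided power
    series over [C] as differentiation and [x] as multiplication by
    [\sum_k c_(x,k) s^(k)], since an iterated commutator with differentiation
    differentiates this multiplier. The monomials that contain [y] become
    shorter, so an induction applies to [t'].

    Gradings enter in two ways. In a graded Lie algebra components of
    non-commuting degrees have zero bracket, and the Jacobi identity spreads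
    this to all monomials having two letters of non-commuting degrees
    ([mon_eval_noncommuting]). On the other hand, let [S] be a set of letters
    with commuting degrees, hence with degrees in an abelian subgroup [K] of
    [G]. For any associative algebra [C] the group algebra [C[K]], realised by
    translations of functions [G -> C], is in V_G because only commuting
    degrees occur in it. Comparing with it shows that the part of [t] with
    letters in [S] vanishes in [C], hence, by the ungraded case, in [H]. These
    partial sums over all [S] determine the sum over all monomials with
    commuting letters ([sum_over_cliques]).

    For the enveloping algebras, a pair whose Lie part is graded by the
    commutator satisfies the weak identities of W_G ([gpair_in_WG]), and a
    strong pair has its algebra in V_G ([strong_gpair_in_VG]): [x * y] and
    [y * x] differ by an element of a common component and lie in different
    ones. The universal properties of the free objects therefore apply to all
    pairs. That a free pair has no superfluous elements, in the Lie part or in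
    the algebra, follows by mapping it to its sub-pair generated by the
    variables and back: by uniqueness the composite is the identity. *)

(** * Algebras of endomorphisms and subalgebras *)

Section SubAlgebra.
Variables (F : fieldType) (A : algType F) (B : {pred A}).
Hypothesis clB : subalg_closed B.

Record subalg_of (cl : subalg_closed B) : predArgType :=
  SubalgOf { subalg_val : A; subalg_valP : subalg_val \in B }.

HB.instance Definition _ := GRing.isSubalgClosed.Build F A B clB.
HB.instance Definition _ := [isSub for @subalg_val clB].
HB.instance Definition _ := [Choice of subalg_of clB by <:].
HB.instance Definition _ := [SubChoice_isSubAlgebra of subalg_of clB by <:].

(** The inclusion under a name of its own, so that it can be packed as a single
    algebra morphism. *)
Definition subalg_incl (x : subalg_of clB) : A := val x.
HB.instance Definition _ :=
  GRing.Linear.copy subalg_incl (val : subalg_of clB -> A).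
HB.instance Definition _ :=
  GRing.RMorphism.copy subalg_incl (val : subalg_of clB -> A).

End SubAlgebra.
Arguments subalg_incl {F A B clB} x.


Section Endomorphisms.
Variables (F : fieldType) (W : lmodType F).

Definition linear_pred : {pred W -> W} := fun f => `[< linear f >].

Fact linear_pred_submod : submod_closed linear_pred.
Proof.
split=> [|c f g /asboolP lf /asboolP lg]; apply/asboolP => a u v.
  by rewrite /= scaler0 addr0.
by rewrite !fctE lf lg !scalerDr !scalerA mulrC addrACA.
Qed.
HB.instance Definition _ :=
  GRing.isSubmodClosed.Build F (W -> W) linear_pred linear_pred_submod.

(** The nonzero vector witnesses that the endomorphism algebra satisfies
    [1 != 0], as the structure of algebra requires. *)
Record endo (w0 : W) (nz : w0 != 0) : predArgType :=
  Endo { endo_fun :> W -> W; endo_linear : endo_fun \in linear_pred }.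

Variables (w0 : W) (nz : w0 != 0).

HB.instance Definition _ := [isSub for @endo_fun w0 nz].
HB.instance Definition _ := [Choice of endo nz by <:].
HB.instance Definition _ := [SubChoice_isSubLmodule of endo nz by <:].

Definition mk_endo f (lf : linear f) : endo nz := Endo nz (asboolT lf).

Lemma endoP (f : endo nz) : linear f.
Proof. exact/asboolP/endo_linear. Qed.
HB.instance Definition _ (f : endo nz) :=
  GRing.isLinear.Build F W W _ (endo_fun f) (@endoP f).

Lemma endo_eqP (f g : endo nz) : f =1 g -> f = g.
Proof. by move=> fg; apply: val_inj; apply: funext. Qed.

Definition endo_one : endo nz :=
  mk_endo (fun a u v => erefl : id _ = a *: id u + id v).
Fact endo_mul_linear (f g : endo nz) : linear (f \o g).
Proof. by move=> a u v /=; rewrite !linearP. Qed.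
Definition endo_mul f g : endo nz := mk_endo (endo_mul_linear f g).

Fact endo_mulA : associative endo_mul.
Proof.
by move=> f g h; apply: endo_eqP.
Qed.
Fact endo_mul1l : left_id endo_one endo_mul.
Proof.
by move=> f; apply: endo_eqP.
Qed.
Fact endo_mul1r : right_id endo_one endo_mul.
Proof.
by move=> f; apply: endo_eqP.
Qed.
Fact endo_mulDl : left_distributive endo_mul +%R.
Proof. by move=> f g h; apply: endo_eqP. Qed.
Fact endo_mulDr : right_distributive endo_mul +%R.
Proof. by move=> f g h; apply: endo_eqP => w /=; rewrite linearD. Qed.
Fact endo_one_neq0 : endo_one != 0.
Proof.
by apply: contra nz => /eqP /(congr1 (fun f : endo nz => f w0)) /= ->.
Qed.
HB.instance Definition _ := GRing.Zmodule_isNzRing.Build (endo nz)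
  endo_mulA endo_mul1l endo_mul1r endo_mulDl endo_mulDr endo_one_neq0.
Fact endo_scaleAl a (f g : endo nz) : a *: (f * g) = a *: f * g.
Proof. by apply: endo_eqP. Qed.
HB.instance Definition _ := GRing.Lmodule_isLalgebra.Build F (endo nz)
  endo_scaleAl.
Fact endo_scaleAr a (f g : endo nz) : a *: (f * g) = f * (a *: g).
Proof. by apply: endo_eqP => w /=; rewrite linearZ. Qed.
HB.instance Definition _ := GRing.Lalgebra_isAlgebra.Build F (endo nz)
  endo_scaleAr.

Lemma endo_sumE I (s : seq I) (P : pred I) (f : I -> endo nz) w :
  (\sum_(i <- s | P i) f i) w = \sum_(i <- s | P i) f i w.
Proof. by elim/big_rec2: _ => [//|i y1 y2 _ <-]. Qed.

End Endomorphisms.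

Lemma const1_neq0 (F : fieldType) (C : algType F) (T : Type) (t : T) :
  (fun=> 1 : C) != 0 :> (T -> C).
Proof. by apply/eqP => /(congr1 (@^~ t)) /= /eqP; rewrite oner_eq0. Qed.

(** * Lie algebras and commutators *)

Section LieTheory.
Variables (F : fieldType) (H : lieAlgType F).
Implicit Types x y z : H.

HB.instance Definition _ x :=
  GRing.isLinear.Build F H H *:%R (lie x) (lie_linearr x).

Lemma lieC x y : lie x y = - lie y x.
Proof.
have lD a b z : lie (a + b) z = lie a z + lie b z.
  by have /= := lie_linearl z 1 a b; rewrite !scale1r.
have := liexx (x + y); rewrite linearD /= !lD !liexx add0r addr0 => /eqP.
by rewrite addrC addr_eq0 => /eqP.
Qed.

Lemma lie_suml I (s : seq I) (f : I -> H) y :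
  lie (\sum_(i <- s) f i) y = \sum_(i <- s) lie (f i) y.
Proof.
by rewrite lieC linear_sum -sumrN; apply: eq_bigr => i _; rewrite [RHS]lieC.
Qed.

Lemma lieDl x y z : lie (x + y) z = lie x z + lie y z.
Proof. by rewrite lieC linearD opprD -!lieC. Qed.

Lemma lieZl c x y : lie (c *: x) y = c *: lie x y.
Proof. by rewrite lieC linearZ -scalerN -lieC. Qed.

Lemma lie0l y : lie 0 y = 0.
Proof. by rewrite lieC linear0 oppr0. Qed.

Lemma ad_derivation x y z : lie x (lie y z) = lie (lie x y) z + lie y (lie x z).
Proof.
have /eqP := lie_jacobi x y z; rewrite -addrA addr_eq0 => /eqP ->.
by rewrite opprD addrC -lieC [lie z x]lieC linearN opprK.
Qed.
End LieTheory.

Section CommutatorLie.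
Variables (F : fieldType) (A : algType F).
(** A copy of [A] carrying the commutator bracket; an alias keeps this Lie
    structure from being inferred for [A] itself. *)
Definition comm_lie : Type := A.
HB.instance Definition _ := GRing.Lmodule.copy comm_lie A.

Fact full_submod : submod_closed (predT : {pred A}).
Proof. by []. Qed.
Definition full_lie : lieSubalg A :=
  @LieSubalg F A predT full_submod (fun _ _ _ _ => isT).

Let tofull (x : A) : lie_sub full_lie := @LieSub F A full_lie x isT.
Let commrl (y : A) : linear ((@commr A)^~ y).
Proof.
by move=> a u v; have /(congr1 val) :=
  lie_linearl (tofull y) a (tofull u) (tofull v).
Qed.
Let commrr (x : A) : linear (@commr A x).
Proof.
by move=> a u v; have /(congr1 val) :=
  lie_linearr (tofull x) a (tofull u) (tofull v).
Qed.
Let commrxx (x : A) : commr x x = 0. Proof. exact: subrr. Qed.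
Let commr_jacobi (x y z : A) :
  commr x (commr y z) + commr y (commr z x) + commr z (commr x y) = 0.
Proof.
by have /(congr1 val) := lie_jacobi (tofull x) (tofull y) (tofull z).
Qed.
HB.instance Definition _ := Lmodule_isLie.Build F comm_lie
  commrl commrr commrxx commr_jacobi.
End CommutatorLie.

(** * Lie polynomials *)

Inductive lie_mon (X : Type) :=
  Letter of X | Bracket of lie_mon X & lie_mon X.

(** Formal linear combinations, without quotient by the Lie axioms: equality of
    Lie polynomials is only ever tested by evaluation. *)
Definition lie_poly (F : fieldType) (X : Type) : Type := seq (F * lie_mon X).

Fixpoint letters X (m : lie_mon X) : seq X :=
  match m with Letter x => [:: x] | Bracket a b => letters a ++ letters b end.

Section Evaluation.
Variables (F : fieldType) (H : lieAlgType F) (X : Type) (u : X -> H).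

Fixpoint mon_eval (m : lie_mon X) : H :=
  match m with
  | Letter x => u x
  | Bracket a b => lie (mon_eval a) (mon_eval b)
  end.

Definition poly_eval (t : lie_poly F X) : H :=
  \sum_(p <- t) p.1 *: mon_eval p.2.

Definition poly_scale (c : F) (t : lie_poly F X) : lie_poly F X :=
  [seq (c * p.1, p.2) | p <- t].

Definition poly_bracket (s t : lie_poly F X) : lie_poly F X :=
  [seq (p.1 * q.1, Bracket p.2 q.2) | p <- s, q <- t].

Lemma poly_eval_cons p t :
  poly_eval (p :: t) = p.1 *: mon_eval p.2 + poly_eval t.
Proof. exact: big_cons. Qed.

Lemma poly_eval_nil : poly_eval [::] = 0. Proof. exact: big_nil. Qed.

Lemma poly_eval_cat s t : poly_eval (s ++ t) = poly_eval s + poly_eval t.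
Proof. exact: big_cat. Qed.

Lemma poly_eval_flatten (I : Type) (s : seq I) (f : I -> lie_poly F X) :
  poly_eval (flatten (map f s)) = \sum_(i <- s) poly_eval (f i).
Proof. by rewrite /poly_eval big_flatten big_map. Qed.

Lemma poly_eval_scale c t : poly_eval (poly_scale c t) = c *: poly_eval t.
Proof.
by rewrite /poly_eval big_map scaler_sumr; apply: eq_bigr => p _;
  rewrite scalerA.
Qed.

Lemma poly_eval_bracket s t :
  poly_eval (poly_bracket s t) = lie (poly_eval s) (poly_eval t).
Proof.
rewrite /poly_eval big_allpairs_dep lie_suml; apply: eq_bigr => p _.
rewrite linear_sum; apply: eq_bigr => q _ /=.
by rewrite lieZl linearZ scalerA.
Qed.
End Evaluation.

Lemma eq_poly_eval (F : fieldType) (H : lieAlgType F) X (u v : X -> H) t :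
  u =1 v -> poly_eval u t = poly_eval v t.
Proof. by move/funext => ->. Qed.

(** Evaluation is parametric: a relation compatible with the Lie operations and
    holding between the values of the letters holds between the values of any
    Lie polynomial. It is used for homomorphisms and, below, for operators that
    induce a given element on a quotient. *)
Lemma poly_eval_rel (F : fieldType) (H1 H2 : lieAlgType F)
    (R : H1 -> H2 -> Prop) X (u1 : X -> H1) (u2 : X -> H2) t :
  R 0 0 ->
  (forall c x1 x2 y1 y2, R x1 x2 -> R y1 y2 -> R (c *: x1 + y1) (c *: x2 + y2))
    ->
  (forall x1 x2 y1 y2, R x1 x2 -> R y1 y2 -> R (lie x1 y1) (lie x2 y2)) ->
  (forall x, R (u1 x) (u2 x)) -> R (poly_eval u1 t) (poly_eval u2 t).
Proof.
move=> R0 RD Rlie Ru; have Rm m : R (mon_eval u1 m) (mon_eval u2 m).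
  by elim: m => [x|a Ra b Rb]; [exact: Ru | exact: Rlie].
elim: t => [|p t IHt]; first by rewrite !poly_eval_nil.
by rewrite !poly_eval_cons; apply: RD.
Qed.

(** * Elimination of a letter *)

Lemma all_flatten_map (I T : Type) (P : pred T) (f : I -> seq T) (s : seq I) :
  all P (flatten (map f s)) = all (fun i => all P (f i)) s.
Proof. by elim: s => //= i s IHs; rewrite all_cat IHs. Qed.

Section Elimination.
Variables (F : fieldType) (X : eqType) (y : X).

(** The letter [(x, k)] stands for [ad(y)^k x], so that [ad(y)] acts on the new
    letters as the derivation [(x, k) |-> (x, k.+1)]. *)
Fixpoint ad_mon (m : lie_mon (X * nat)) : seq (lie_mon (X * nat)) :=
  match m with
  | Letter x => [:: Letter (x.1, x.2.+1)]
  | Bracket a b =>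
      [seq Bracket a' b | a' <- ad_mon a] ++ [seq Bracket a b' | b' <- ad_mon b]
  end.

Definition ad_poly (t : lie_poly F (X * nat)) : lie_poly F (X * nat) :=
  flatten [seq [seq (p.1, m) | m <- ad_mon p.2] | p <- t].

(** The monomial [m] is rewritten as [c y + p] with [c] a boolean and [p] a Lie
    polynomial in the new letters; a bracket of two such expressions is expanded
    by bilinearity, [y] acting as [ad(y)]. The tests on [c], in place of
    multiplications by [c], keep [p] syntactically free of terms with
    coefficient zero: the bounds below concern every listed monomial. *)
Fixpoint elim_mon (m : lie_mon X) : bool * lie_poly F (X * nat) :=
  match m with
  | Letter x =>
      if x == y then (true, [::]) else (false, [:: (1, Letter (x, 0))])
  | Bracket a b =>
      (false,
       (if (elim_mon a).1 then ad_poly (elim_mon b).2 else [::])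
       ++ (if (elim_mon b).1 then poly_scale (-1) (ad_poly (elim_mon a).2)
           else [::])
       ++ poly_bracket (elim_mon a).2 (elim_mon b).2)
  end.

Section Eval.
Variables (H : lieAlgType F) (d : H) (u : X -> H).
Let v (p : X * nat) : H := iter p.2 (lie d) (u p.1).

Lemma ad_monE m : \sum_(m' <- ad_mon m) mon_eval v m' = lie d (mon_eval v m).
Proof.
elim: m => [[x k]|a IHa b IHb] /=; first by rewrite big_seq1.
rewrite big_cat !big_map /= ad_derivation -IHa -IHb lie_suml; congr (_ + _).
by rewrite linear_sum.
Qed.

Lemma ad_polyE t : poly_eval v (ad_poly t) = lie d (poly_eval v t).
Proof.
rewrite poly_eval_flatten linear_sum; apply: eq_bigr => p _.
by rewrite /poly_eval big_map /= linearZ /= -ad_monE scaler_sumr.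
Qed.

(** The value [d] of the letter [y] and the values [u] of the new letters
    [(x, 0)] are kept independent, even at [x = y]: this allows [y] to be
    evaluated at an operator of another nature than the other letters. *)
Lemma elim_monE m :
  mon_eval (fun x => if x == y then d else u x) m
  = (elim_mon m).1%:R *: d + poly_eval v (elim_mon m).2.
Proof.
elim: m => [x|a IHa b IHb] /=.
  case: eqVneq => _ /=; first by rewrite poly_eval_nil scale1r addr0.
  by rewrite poly_eval_cons poly_eval_nil !scale1r scale0r add0r addr0.
rewrite IHa IHb !poly_eval_cat poly_eval_bracket scale0r add0r.
set p := poly_eval v (elim_mon a).2; set q := poly_eval v (elim_mon b).2.
rewrite linearD /= !lieDl lieZl [lie p (_ *: d)]lieC lieZl linearZ /= liexx
  !scaler0 add0r.
rewrite addrCA lieZl; congr (_ + (_ + _)).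
  by case: (elim_mon a).1; rewrite ?ad_polyE ?poly_eval_nil ?scale1r ?scale0r.
case: (elim_mon b).1; rewrite ?poly_eval_scale ?ad_polyE ?poly_eval_nil
  ?scale1r ?scale0r ?oppr0 //.
by rewrite scaleN1r.
Qed.
End Eval.

Definition all_mon (P : lie_mon (X * nat) -> bool) (t : lie_poly F (X * nat)) :=
  all (fun p => P p.2) t.

Lemma all_mon_cat P s t : all_mon P (s ++ t) = all_mon P s && all_mon P t.
Proof. exact: all_cat. Qed.

Lemma all_mon_scale P c t : all_mon P t -> all_mon P (poly_scale c t).
Proof. by rewrite /all_mon all_map. Qed.

Lemma all_mon_ad (P : nat -> bool) t :
  all_mon (fun m => P (size (letters m))) t ->
  all_mon (fun m => P (size (letters m))) (ad_poly t).
Proof.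
rewrite /all_mon all_flatten_map; apply: sub_all => -[c m] /= Pm.
rewrite all_map.
rewrite -[X in is_true X]/(all (fun m' => P (size (letters m'))) (ad_mon m)).
elim: m P Pm => [x|a IHa b IHb] P /=; first by rewrite andbT.
rewrite all_cat !all_map size_cat => Pab; apply/andP; split.
  under eq_all => m /= do rewrite size_cat.
  exact: (IHa (fun n => P (n + _)%N)).
under eq_all => m /= do rewrite size_cat.
exact: (IHb (fun n => P (_ + n)%N)).
Qed.

Lemma all_mon_bracket (P Q R : lie_mon (X * nat) -> bool) s t :
  (forall a b, P a -> Q b -> R (Bracket a b)) ->
  all_mon P s -> all_mon Q t -> all_mon R (poly_bracket s t).
Proof.
move=> PQR; elim: s => [//|p s IHs] /= /andP[Pp Ps] Qt.
rewrite /all_mon /poly_bracket /= all_cat; apply/andP; split; last exact: IHs.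
by rewrite all_map; apply: sub_all Qt => q /= /PQR; apply.
Qed.

(** Each occurrence of [y] is absorbed into the index of a new letter. Hence the
    new monomials are strictly shorter when [y] occurs. *)
Lemma elim_size m :
  all_mon
    (fun q => size (letters q) + count_mem y (letters m) <= size (letters m))%N
    (elim_mon m).2.
Proof.
elim: m => [x|a IHa b IHb] /=; first by case: eqVneq.
have cnt s : (count_mem y s <= size s)%N := count_size _ s.
rewrite !all_mon_cat size_cat count_cat; apply/and3P; split.
- case: (elim_mon a).1 => //.
  pose P n := (n + (count_mem y (letters a) + count_mem y (letters b))
    <= size (letters a) + size (letters b))%N.
  apply: (all_mon_ad (P := P)).
  move: IHb; apply: sub_all => q /= qb; rewrite /P addnCA leq_add ?cnt //.
- case: (elim_mon b).1 => //.
  pose P n := (n + (count_mem y (letters a) + count_mem y (letters b))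
    <= size (letters a) + size (letters b))%N.
  apply: (all_mon_scale (P := fun m => P (size (letters m)))).
  apply: (all_mon_ad (P := P)).
  by move: IHa; apply: sub_all => q /= qa; rewrite /P addnA leq_add ?cnt.
apply: all_mon_bracket IHa IHb => p q /= pa qb.
by rewrite size_cat addnACA leq_add.
Qed.

(** A monomial without [y] is only relabelled: its length is unchanged, but no
    new letter has come in, which is what makes the elimination terminate. *)
Lemma elim_absent m : y \notin letters m ->
  (elim_mon m).1 = false /\
  all_mon (fun q => letters q == [seq (x, 0) | x <- letters m]) (elim_mon m).2.
Proof.
elim: m => [x|a IHa b IHb] /=.
  by rewrite inE eq_sym => /negbTE -> /=; rewrite eqxx.
rewrite mem_cat negb_or => /andP[/IHa[-> ea] /IHb[-> eb]]; split=> //=.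
apply: all_mon_bracket ea eb => p q /eqP pa /eqP qb.
by rewrite /= pa qb map_cat.
Qed.
End Elimination.

(** * The free Lie algebra embeds in the free associative algebra *)

Section Hurwitz.
Variables (F : fieldType) (C : algType F).

(** Coefficient [n] of the product of two divided power series
    [\sum_k a_k s^(k)] and [\sum_k f_k s^(k)]. Differentiation shifts the
    coefficients, and the recursion is the Leibniz rule: unlike the formula with
    binomial coefficients, it makes the commutator with the shift computable by
    unfolding, in every characteristic. *)
Fixpoint hurwitz_mul (n : nat) (a f : nat -> C) : C :=
  match n with
  | 0 => a 0%N * f 0%N
  | n.+1 => hurwitz_mul n (a \o S) f + hurwitz_mul n a (f \o S)
  end.

Let series_nz := const1_neq0 C 0%N.

Fact hurwitz_linear a : linear (fun f n => hurwitz_mul n a f).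
Proof.
move=> c f g; apply: funext => n; rewrite !fctE /=.
elim: n a f g => [|n IHn] a f g /=; first by rewrite mulrDr -scalerAr.
by rewrite (IHn (a \o S)) (IHn a (f \o S) (g \o S)) scalerDr addrACA.
Qed.
Definition hurwitz a : endo series_nz := mk_endo _ (hurwitz_linear a).

Fact shift_linear : linear (fun f : nat -> C => f \o S).
Proof. by []. Qed.
Definition shift : endo series_nz := mk_endo _ shift_linear.

(** This is the Leibniz rule, that is, the recursion defining the product. *)
Lemma commr_shift_hurwitz a : commr shift (hurwitz a) = hurwitz (a \o S).
Proof. by apply: endo_eqP => f; apply: funext => n; exact: addrK. Qed.

Lemma iter_commr_shift k a :
  iter k (commr shift) (hurwitz a) = hurwitz (fun j => a (j + k)%N).
Proof.
elim: k => [|k IHk]; first by congr hurwitz; apply: funext => j; rewrite addn0.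
rewrite iterS IHk commr_shift_hurwitz; congr hurwitz; apply: funext => j /=.
by rewrite addSnnS.
Qed.

(** Multiplication by a series acts on constant terms as multiplication by its
    own constant term, and the constant term of the [k]-th derivative is the
    coefficient [rho (x, k)]. So arbitrary values of the letters [(x, k)] are
    realised as [ad(shift)^k] of one operator for each [x]. *)
Lemma hurwitz_eval X (rho : X * nat -> C) (t : lie_poly F (X * nat)) f :
  (poly_eval (H := comm_lie (endo series_nz))
     (fun p => iter p.2 (commr shift) (hurwitz (fun k => rho (p.1, k)))) t
   : endo _) f 0%N
  = poly_eval (H := comm_lie C) rho t * f 0%N.
Proof.
pose R (A : comm_lie (endo series_nz)) (c : comm_lie C) :=
  forall f, (A : endo _) f 0%N = (c : C) * f 0%N.
move: f; apply: (poly_eval_rel (R := R)).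
- by move=> f; rewrite mul0r.
- move=> c A1 c1 A2 c2 R1 R2 f /=.
  by rewrite mulrDl -scalerAl -R1 -R2.
- move=> A1 c1 A2 c2 R1 R2 f /=.
  have -> : lie c1 c2 * f 0%N = c1 * (c2 * f 0%N) - c2 * (c1 * f 0%N) :> C.
    by rewrite !mulrA -mulrBl.
  by rewrite -R1 -R2 -R1 -R2.
- by move=> [x k] f; rewrite iter_commr_shift.
Qed.
End Hurwitz.

Definition assoc_identity (F : fieldType) X (t : lie_poly F X) :=
  forall (C : algType F) (rho : X -> C), poly_eval (H := comm_lie C) rho t = 0.

Section EliminatePoly.
Variables (F : fieldType) (X : eqType) (y : X).

Definition elim_poly (t : lie_poly F X) : lie_poly F (X * nat) :=
  flatten [seq poly_scale p.1 (elim_mon F y p.2).2 | p <- t].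

Lemma elim_polyE (H : lieAlgType F) (d : H) (u : X -> H) t :
  poly_eval (fun x => if x == y then d else u x) t
  = (\sum_(p <- t) p.1 * (elim_mon F y p.2).1%:R) *: d
    + poly_eval (fun p => iter p.2 (lie d) (u p.1)) (elim_poly t).
Proof.
rewrite poly_eval_flatten scaler_suml -big_split /=; apply: eq_bigr => p _.
by rewrite elim_monE poly_eval_scale scalerDr scalerA.
Qed.

(** Stability of identities under elimination of [y], proved by feeding suitable
    operators on power series to the identity [t]. *)
Lemma elim_poly_identity t : assoc_identity t ->
  assoc_identity (elim_poly t) /\
  \sum_(p <- t) p.1 * (elim_mon F y p.2).1%:R = 0.
Proof.
move=> t0; have t'0 : assoc_identity (elim_poly t).
  move=> C rho.
  pose nz := const1_neq0 C 0%N.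
  pose u x : endo nz := hurwitz (fun k => rho (x, k)).
  (* The letter y is evaluated at the shift, x at multiplication by its series. *)
  have := t0 (endo nz) (fun x => if x == y then shift C else u x).
  rewrite (elim_polyE (H := comm_lie (endo nz)) (shift C) u) => tu.
  (* The shift kills the series 1, which removes the multiple of y. *)
  pose f n : C := (n == 0%N)%:R.
  have /= := congr1 (fun A : endo nz => A f 0%N) tu.
  rewrite !fctE /= (hurwitz_eval rho (elim_poly t)) /f /=.
  by rewrite scaler0 add0r mulr1.
split=> //.
(* In the commutative algebra F, with y at 1, only the multiple of y is left. *)
have := t0 (F^o : algType F) (fun x => if x == y then 1 else 0).
rewrite (elim_polyE (H := comm_lie (F^o : algType F)) 1 (fun=> 0)).
by rewrite t'0 addr0 => /eqP; rewrite scaler_eq0 oner_eq0 orbF => /eqP.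
Qed.
End EliminatePoly.

(** Lexicographic induction on the maximal length [n] of the monomials and on a
    list [ys] of the letters that occur in monomials of maximal length.
    Eliminating a letter of [ys] makes the monomials containing it shorter and
    relabels the others, so [ys] loses a letter; once [ys] is empty, [n] drops.
    The set of letters changes along the way, whence the quantifier on [X]. *)
Lemma lie_identity_of_assoc_bounded (F : fieldType) n (X : eqType)
    (ys : seq X) (t : lie_poly F X) :
  all (fun p => (size (letters p.2) < n)%N
         || (size (letters p.2) == n) && all (mem ys) (letters p.2)) t ->
  assoc_identity t -> forall (H : lieAlgType F) (u : X -> H), poly_eval u t = 0.
Proof.
have pos (T : Type) (m : lie_mon T) : (0 < size (letters m))%N.
  by elim: m => //= a IHa b _; rewrite size_cat ltn_addr.
elim: n X ys t => [|n IHn] X ys t.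
  case: t => [|p t] /=; first by move=> *; exact: poly_eval_nil.
  by rewrite eqn0Ngt pos.
have [k] := ubnP (size ys).
elim: k X ys t => // k IHk X [|y ys] t /= szys tn t0 H u.
  apply: (IHn _ (flatten [seq letters p.2 | p <- t])) => //.
  have {}tn : all (fun p => size (letters p.2) <= n)%N t.
    apply: sub_all tn => p /= /orP[//|/andP[_]].
    by have := pos _ p.2; case: (letters p.2).
  have ys' : all (fun p => all (mem (flatten [seq letters p.2 | p <- t]))
    (letters p.2)) t.
    by rewrite -all_flatten_map; apply/allP.
  have : all (predI (fun p => size (letters p.2) <= n)%N
    (fun p => all (mem (flatten [seq letters p.2 | p <- t])) (letters p.2))) t.
    by rewrite all_predI tn.
  by apply: sub_all => p /= /andP[]; rewrite leq_eqVlt orbC => + ->;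
    rewrite andbT.
have [t'0 c0] := elim_poly_identity y t0.
have -> : poly_eval u t = poly_eval (fun x => if x == y then u y else u x) t.
  by apply: eq_poly_eval => x; case: eqVneq => // ->.
rewrite elim_polyE c0 scale0r add0r.
apply: (IHk _ [seq (x, 0%N) | x <- ys]) => //; first by rewrite size_map.
rewrite all_flatten_map; apply: sub_all tn => -[c m] /= mn.
rewrite all_map /=.
have [ym|ym] := boolP (y \in letters m).
  apply: sub_all (elim_size F y m) => -[c' q] /= qm.
  apply/orP; left; have cnt : (0 < count_mem y (letters m))%N.
    by rewrite -has_count has_pred1.
  have szm : (size (letters m) <= n.+1)%N.
    by case/orP: mn => [/ltnW|/andP[/eqP->]].
  by apply: leq_trans szm; apply: leq_trans qm; rewrite -addn1 leq_add2l.
apply: sub_all (elim_absent F ym).2 => -[c' q] /= /eqP ->.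
rewrite size_map; case/orP: mn => [->//|/andP[-> mys]] /=; apply/orP; right.
apply/allP => _ /mapP[x xm ->]; apply: map_f.
by have := allP mys _ xm; rewrite inE => /orP[/eqP xy|//]; rewrite -xy xm in ym.
Qed.

(** In other words, the Lie algebra generated by the letters in the free
    associative algebra is free. *)
Theorem lie_identity_of_assoc (F : fieldType) (X : Type) (t : lie_poly F X) :
  assoc_identity t -> forall (H : lieAlgType F) (u : X -> H), poly_eval u t = 0.
Proof.
pose n := (\max_(p <- t) size (letters p.2)).+1.
move=> t0 H u.
apply: (@lie_identity_of_assoc_bounded F n {classic X} [::]) => //.
have : all (fun p => size (letters p.2) < n)%N t.
  rewrite /n; elim: (t) => //= p s IHs; rewrite big_cons !ltnS leq_maxl /=.
  by apply: sub_all IHs => q; rewrite !ltnS leq_max => ->; rewrite orbT.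
by apply: sub_all => p ->.
Qed.

(** * Direct decompositions *)

Section Decompositions.
Variables (G : groupType) (F : fieldType).

Lemma sum_by_degree (V : nmodType) (I : Type) (r : seq I) (d : I -> G)
    (f : I -> V) :
  \sum_(i <- r) f i
  = \sum_(g <- undup [seq d i | i <- r]) \sum_(i <- r | d i == g) f i.
Proof.
have: all (fun i => d i \in undup [seq d i | i <- r]) r.
  rewrite -[X in is_true X]/(all (preim d (mem (undup [seq d i | i <- r]))) r).
  by rewrite -all_map; apply/allP => g; rewrite /= mem_undup.
move: (undup _) (undup_uniq [seq d i | i <- r]) => s us.
under [RHS]eq_bigr => g _ do rewrite big_mkcond /=.
rewrite exchange_big /=; elim: r => [|i r IHr] /= => [|/andP[dis dr]].
  by rewrite !big_nil.
rewrite !big_cons -IHr //; congr (_ + _).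
rewrite (bigD1_seq (d i)) //= eqxx big1 ?addr0 // => g.
by rewrite eq_sym => /negbTE ->.
Qed.

Variables (V : lmodType F) (V_ : G -> {pred V}).
Hypothesis dV : direct_decomp V_.

Lemma decomp0 g : 0 \in V_ g.
Proof. by case: dV => /(_ g)[]. Qed.

Lemma decompZD g c x y : x \in V_ g -> y \in V_ g -> c *: x + y \in V_ g.
Proof. by case: dV => /(_ g)[_ cl] _ _; exact: cl. Qed.

Lemma decompD g x y : x \in V_ g -> y \in V_ g -> x + y \in V_ g.
Proof. by rewrite -{2}[x]scale1r; exact: decompZD. Qed.

Lemma decompZ g c x : x \in V_ g -> c *: x \in V_ g.
Proof. by move=> xg; rewrite -[_ *: _]addr0 decompZD ?decomp0. Qed.

Lemma decomp_sum g I (s : seq I) (P : pred I) (f : I -> V) :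
  (forall i, P i -> f i \in V_ g) -> \sum_(i <- s | P i) f i \in V_ g.
Proof.
by move=> fg; elim/big_ind: _ => //; [exact: decomp0|exact: decompD].
Qed.

(** Uniqueness of components, in the form used throughout: independence is
    applied to the given decomposition with [v] subtracted in degree [g]. *)
Lemma decomp_homogeneous g v (s : seq G) (w : G -> V) :
  v \in V_ g -> uniq s -> (forall h, w h \in V_ h) -> v = \sum_(h <- s) w h ->
  forall h, h \in s -> h != g -> w h = 0.
Proof.
move=> vg us ws vE h hs hg; have [_ _ indep] := dV.
pose w' k := (if (k == g) then (if g \in s then w g else 0) - v else w k).
have w's k : w' k \in V_ k.
  rewrite /w'; case: eqVneq => [->|//]; rewrite addrC -scaleN1r decompZD //.
  by case: ifP => // _; exact: decomp0.
have := indep (g :: [seq k <- s | k != g]) w' _ w's.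
rewrite /= mem_filter eqxx filter_uniq //= => /(_ isT) w'0.
have /w'0 : \sum_(k <- g :: [seq k <- s | k != g]) w' k = 0.
  rewrite big_cons big_filter {1}/w' eqxx.
  rewrite (eq_bigr w) => [|k kg]; last by rewrite /w' (negbTE kg).
  rewrite vE; apply/eqP; rewrite addrAC subr_eq0; apply/eqP.
  case: ifP => gs; first by rewrite [RHS](bigD1_seq g).
  rewrite add0r [RHS]big_seq [LHS]big_seq_cond; apply: eq_bigl => k.
  by rewrite andbC; case: eqVneq => // ->; rewrite gs.
move/(_ h); rewrite inE mem_filter hs hg orbT => /(_ isT).
by rewrite /w' (negbTE hg).
Qed.

Lemma decomp_disjoint g h x : g != h -> x \in V_ g -> x \in V_ h -> x = 0.
Proof.
move=> gh xg xh.
pose w k := if k == h then x else 0.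
have ws k : w k \in V_ k by rewrite /w; case: eqVneq => [->//|_];
  exact: decomp0.
have := decomp_homogeneous xg (s := [:: h]) isT ws _ (mem_head _ _).
by rewrite eq_sym gh big_seq1 /w eqxx => ->.
Qed.
End Decompositions.

(** * Lie monomials in a graded Lie algebra *)

Section GradedLie.
Variables (G : groupType) (F : fieldType) (X : Type) (deg : X -> G).

Fixpoint mon_deg (m : lie_mon X) : G :=
  match m with
  | Letter x => deg x
  | Bracket a b => (mon_deg a * mon_deg b)%g
  end.

Definition commuting_letters (m : lie_mon X) : Prop :=
  forall g h, g \in map deg (letters m) -> h \in map deg (letters m) ->
    commute g h.

Section InGradedLie.
Variables (H : lieAlgType F) (H_ : G -> {pred H}).
Hypothesis gH : lie_grading H_.
Let dH := gH.1.

(** By antisymmetry the bracket lies in both components [g h] and [h g]. *)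
Lemma lie_noncommuting g h x y :
  x \in H_ g -> y \in H_ h -> ~ commute g h -> lie x y = 0.
Proof.
move=> xg yh cgh; apply: (decomp_disjoint dH (g := g * h) (h := h * g))%g.
- by apply/eqP.
- exact: gH.2.
by rewrite lieC -scaleN1r (decompZ dH) ?gH.2.
Qed.

Variable u : X -> H.
Hypothesis uH : respects deg H_ u.

Lemma mon_eval_deg m : mon_eval u m \in H_ (mon_deg m).
Proof. by elim: m => [x|a IHa b IHb] /=; [exact: uH | exact: gH.2]. Qed.

(** Say that [m] is the bracket of [a] and [b], with the letter of degree [g] in
    [a]. By the Jacobi identity it is enough to bracket [a] with [w] and with
    the bracket of [w] and [b]. If the degree [h] of [b] commutes with [g], then
    neither [k] nor [k h] commutes with [g] and both brackets vanish by
    induction; if it does not, [m] itself vanishes by induction, with [b] in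
    place of [w]. *)
Lemma lie_mon_noncommuting m g k w : g \in map deg (letters m) ->
  w \in H_ k -> ~ commute k g -> lie w (mon_eval u m) = 0.
Proof.
elim: m k w => [x|a IHa b IHb] k w /=.
  by rewrite inE => /eqP -> wk kg; exact: lie_noncommuting wk (uH x) kg.
have side (a' b' : lie_mon X) :
  (forall k w, w \in H_ k -> ~ commute k g -> lie w (mon_eval u a') = 0) ->
  w \in H_ k -> ~ commute k g ->
  lie w (lie (mon_eval u a') (mon_eval u b')) = 0.
  move=> IH wk kg; have [bg|bg] := pselect (commute (mon_deg b') g); last first.
    by rewrite [lie (mon_eval u a') _]lieC (IH _ _ (mon_eval_deg b')) // oppr0
      linear0.
  rewrite ad_derivation (IH _ _ wk kg) lie0l add0r lieC.
  rewrite (IH (k * mon_deg b')%g) ?oppr0 //;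
    first exact: gH.2 (mon_eval_deg b').
  move=> kbg; apply: kg; rewrite /commute.
  by apply: (mulIg (mon_deg b')); rewrite -mulgA -bg mulgA kbg mulgA.
rewrite map_cat mem_cat => /orP[ga|gb] wk kg.
  by apply: (side a b) => // k' w'; exact: IHa.
rewrite [lie (mon_eval u a) _]lieC linearN /= (side b a) ?oppr0 // => k' w'.
exact: IHb.
Qed.

(** Induction on [a], for all [b]: when [a] is a bracket, the Jacobi identity
    gives brackets of its two parts with [b] and with [Bracket _ b], and each of
    these contains the letter of degree [h]. *)
Lemma lie_mon_cross a b g h : g \in map deg (letters a) ->
  h \in map deg (letters b) -> ~ commute g h ->
  lie (mon_eval u a) (mon_eval u b) = 0.
Proof.
elim: a b => [x|a1 IH1 a2 IH2] b /=.
  by rewrite inE => /eqP -> hb gh; exact: lie_mon_noncommuting hb (uH x) gh.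
rewrite map_cat mem_cat => ga hb gh.
have hB c : h \in map deg (letters (Bracket c b)).
  by rewrite /= map_cat mem_cat hb orbT.
have -> : lie (lie (mon_eval u a1) (mon_eval u a2)) (mon_eval u b)
    = lie (mon_eval u a1) (mon_eval u (Bracket a2 b))
      - lie (mon_eval u a2) (mon_eval u (Bracket a1 b)).
  by rewrite /= [X in _ = X - _]ad_derivation addrK.
case/orP: ga => ga.
  by rewrite (IH1 (Bracket a2 b)) ?hB //= (IH1 b) // linear0 subrr.
by rewrite (IH2 (Bracket a1 b)) ?hB //= (IH2 b) // linear0 subrr.
Qed.

Lemma mon_eval_noncommuting m : ~ commuting_letters m -> mon_eval u m = 0.
Proof.
apply: contra_notP => /eqP; elim: m => [x|a IHa b IHb] /= ab0 g h.
  by rewrite !inE => /eqP -> /eqP ->.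
have a0 : mon_eval u a != 0 by apply: contraNneq ab0 => ->; rewrite lie0l.
have b0 : mon_eval u b != 0 by apply: contraNneq ab0 => ->; rewrite linear0.
have cross g' h' : g' \in map deg (letters a) ->
    h' \in map deg (letters b) -> commute g' h'.
  by move=> ga hb; apply/not_notP => gh; move/eqP: ab0;
    rewrite (lie_mon_cross ga hb gh).
rewrite map_cat !mem_cat => /orP[ga|gb] /orP[ha|hb].
- exact: IHa.
- exact: cross.
- exact/commute_sym/cross.
exact: IHb.
Qed.
End InGradedLie.
End GradedLie.

(** * The algebra spanned by a multiplicative family of subspaces *)

Section GradedSpan.
Variables (G : groupType) (F : fieldType) (E : algType F) (E_ : G -> {pred E}).
Hypotheses (E_submod : forall g, submod_closed (E_ g)) (E_one : 1 \in E_ 1%g)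
  (E_mul : forall g h x y, x \in E_ g -> y \in E_ h -> x * y \in E_ (g * h)%g)
  (E_indep : forall (s : seq G) (w : G -> E), uniq s ->
     (forall g, w g \in E_ g) -> \sum_(g <- s) w g = 0 ->
     forall g, g \in s -> w g = 0).

(** Lists of homogeneous elements, rather than families indexed by degrees: sums
    and products of such expressions are then list operations, and terms of
    equal degree are collected only in [span_alg_grading]. *)
Definition graded_span : {pred E} := fun a =>
  `[< exists2 l : seq (G * E), {in l, forall p, p.2 \in E_ p.1}
      & a = \sum_(p <- l) p.2 >].

Lemma graded_span_homogeneous g x : x \in E_ g -> x \in graded_span.
Proof.
move=> xg; apply/asboolP; exists [:: (g, x)]; last by rewrite big_seq1.
by move=> p; rewrite inE => /eqP ->.
Qed.

Fact graded_span_subalg : subalg_closed graded_span.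
Proof.
split.
- exact: graded_span_homogeneous E_one.
- move=> c a b /asboolP[l lE ->] /asboolP[l' l'E ->]; apply/asboolP.
  exists ([seq (p.1, c *: p.2) | p <- l] ++ l').
    move=> p; rewrite mem_cat => /orP[/mapP[q ql ->] /=|/l'E //].
    have [z cl] := E_submod q.1; rewrite -[_ *: _]addr0; apply: cl => //.
    exact: lE.
  by rewrite big_cat big_map -scaler_sumr.
move=> a b /asboolP[l lE ->] /asboolP[l' l'E ->]; apply/asboolP.
exists [seq ((p.1 * q.1)%g, p.2 * q.2) | p <- l, q <- l'].
  by move=> _ /allpairsP[[p q] [/= pl ql' ->]] /=; apply: E_mul;
    [exact: lE|exact: l'E].
rewrite big_allpairs_dep mulr_suml; apply: eq_bigr => p _.
by rewrite mulr_sumr.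
Qed.

Definition span_alg : algType F := subalg_of graded_span_subalg.
Definition span_gr (g : G) : {pred span_alg} := fun x => subalg_incl x \in E_ g.

Lemma span_algP a : a \in graded_span -> {x : span_alg | subalg_incl x = a}.
Proof. by move=> sa; exists (SubalgOf graded_span_subalg sa). Qed.

Lemma span_alg_grading : alg_grading span_gr.
Proof.
split; last by move=> g h x y xg yh; rewrite /span_gr unfold_in rmorphM;
  exact: E_mul.
have inj : injective (subalg_incl : span_alg -> E) := val_inj.
have clS g : submod_closed (span_gr g).
  have [z cl] := E_submod g.
  split=> [|c x y xg yg]; rewrite /span_gr unfold_in; first by rewrite raddf0.
  by rewrite linearP; exact: cl.
split=> //.
- move=> x; have /asboolP[l lE xl] := subalg_valP x.
  have f (p : G * E) : {y : span_alg | y \in span_gr p.1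
      & p \in l -> subalg_incl y = p.2}.
    have [pl|pl] := boolP (p \in l); last first.
      by exists 0 => //; case: (clS p.1).
    have [y yp] := span_algP (graded_span_homogeneous (lE _ pl)).
    by exists y => //; rewrite /span_gr unfold_in yp; exact: lE.
  exists (undup [seq p.1 | p <- l]).
  exists (fun g => \sum_(p <- l | p.1 == g) s2val (f p)).
  split=> [g|].
    have [z cl] := clS g.
    apply: (big_ind (fun y => y \in span_gr g)) => // [y y' yg y'g|p /eqP <-].
      by rewrite -[y]scale1r; exact: cl.
    exact: (s2valP (f p)).
  rewrite -sum_by_degree; apply: inj; rewrite raddf_sum.
  rewrite -[LHS]/(subalg_val x) xl big_seq [RHS]big_seq; apply: eq_bigr => p pl.
  exact/esym/(s2valP' (f p) pl).
move=> s w us ws w0 g gs; apply: inj; rewrite raddf0.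
apply: (E_indep us (w := subalg_incl \o w)) gs; first exact: ws.
by rewrite -raddf_sum w0 raddf0.
Qed.
End GradedSpan.

(** * Algebras of the variety attached to commuting letters *)

Section VGModel.
Variables (G : groupType) (F : fieldType) (C : algType F).
Variables (X : Type) (deg : X -> G) (S : pred X).
Hypothesis S_comm : forall x y, S x -> S y -> commute (deg x) (deg y).

(** The bicentralizer of the degrees of the letters in [S]: an abelian subgroup
    containing these degrees. *)
Definition bicentral (g : G) : Prop :=
  forall h, (forall x, S x -> commute (deg x) h) -> commute g h.

Lemma bicentral_commute g h : bicentral g -> bicentral h -> commute g h.
Proof.
move=> gK hK; apply: gK => x Sx; apply/commute_sym; apply: hK => y Sy.
exact: S_comm.
Qed.

Let nz := const1_neq0 C (1%g : G).

Fact translate_linear g (c : C) :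
  linear (fun (f : G -> C) h => c * f (g^-1 * h)%g).
Proof.
by move=> a f f'; apply: funext => h; rewrite !fctE /= mulrDr scalerAr.
Qed.
(** The element [c g] of the group algebra [C[G]], acting on the functions
    [G -> C]. *)
Definition translate g c : endo nz := mk_endo _ (translate_linear g c).

(** The component of degree [g] of the group algebra of the bicentralizer; it is
    zero for [g] outside of that subgroup. *)
Definition translations (g : G) : {pred endo nz} := fun T =>
  `[< exists2 c, ~ bicentral g -> c = 0 & T = translate g c >].

Lemma translate0 g : translate g 0 = 0.
Proof. by apply: endo_eqP => f; apply: funext => h; rewrite /= mul0r. Qed.

Lemma translateM g h c d :
  translate g c * translate h d = translate (g * h)%g (c * d).
Proof.
by apply: endo_eqP => f; apply: funext => k; rewrite /= -mulrA invgM mulgA.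
Qed.

Fact translations_submod g : submod_closed (translations g).
Proof.
split=> [|a T T']; first by apply/asboolP; exists 0; rewrite ?translate0.
move=> /asboolP[c cg ->] /asboolP[d dg ->]; apply/asboolP.
exists (a *: c + d) => [ng|]; first by rewrite cg // dg // scaler0 addr0.
by apply: endo_eqP => f; apply: funext => h;
  rewrite /= !fctE /= mulrDl scalerAl.
Qed.

Fact translations_one : 1 \in translations 1%g.
Proof.
apply/asboolP; exists 1 => [[]h _|]; first exact/commute_sym/commute1.
by apply: endo_eqP => f; apply: funext => h; rewrite /= mul1r invg1 mul1g.
Qed.

Fact translations_mul g h T T' :
  T \in translations g -> T' \in translations h ->
  T * T' \in translations (g * h)%g.
Proof.
move=> /asboolP[c cg ->] /asboolP[d dg ->]; apply/asboolP.
exists (c * d); last exact: translateM.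
move=> ghK; have [gK|/cg ->] := pselect (bicentral g); last by rewrite mul0r.
rewrite dg ?mulr0 // => hK; apply: ghK => k kS.
exact/commute_sym/commuteM/commute_sym/hK/kS/commute_sym/gK.
Qed.

Fact translations_indep (s : seq G) (w : G -> endo nz) : uniq s ->
  (forall g, w g \in translations g) -> \sum_(g <- s) w g = 0 ->
  forall g, g \in s -> w g = 0.
Proof.
move=> us wt w0 g gs.
have /choice[c wc] : forall h, exists c, w h = translate h c.
  by move=> h; have /asboolP[c _ ->] := wt h; exists c.
suff c0 : c g = 0 by rewrite wc c0 translate0.
(* The function supported at the unit separates the translations. *)
have := congr1 (fun T : endo nz => T (fun h => (h == 1%g)%:R) g) w0.
rewrite endo_sumE fct_sumE (bigD1_seq g) //= wc /= mulVg eqxx mulr1.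
rewrite big1 ?addr0 // => h hg; rewrite wc /=.
by rewrite -(inj_eq (mulgI h)) mulg1 mulVKg eq_sym (negbTE hg) mulr0.
Qed.

Definition VG_model : algType F :=
  span_alg translations_submod translations_one translations_mul.
Definition VG_model_gr : G -> {pred VG_model} :=
  @span_gr G F _ _ translations_submod translations_one translations_mul.

(** Two nonzero components have degrees in the abelian group [bicentral]. *)
Lemma VG_model_in_VG : in_VG VG_model_gr.
Proof.
split; first exact: span_alg_grading translations_indep.
move=> g h a b /eqP gh /asboolP[c cg ac] /asboolP[d dh bd]; apply: val_inj.
have -> : val (a * b) = subalg_incl a * subalg_incl b by [].
rewrite ac bd translateM.
have [gK|/cg ->] := pselect (bicentral g); last by rewrite mul0r translate0.
have [hK|/dh ->] := pselect (bicentral h); last by rewrite mulr0 translate0.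
by case: gh; apply/eqP/commgP; exact: bicentral_commute.
Qed.

Variable rho : X -> C.
Hypothesis rhoS : forall x, ~~ S x -> rho x = 0.

Lemma VG_model_var x : {v : VG_model | v \in VG_model_gr (deg x)
  & subalg_incl v = translate (deg x) (rho x)}.
Proof.
have tx : translate (deg x) (rho x) \in translations (deg x).
  apply/asboolP; exists (rho x) => // ng; apply: rhoS; apply/negP => Sx.
  by apply: ng => h; apply.
have [v vE] := span_algP translations_submod translations_one translations_mul
  (graded_span_homogeneous tx).
by exists v => //; rewrite unfold_in /VG_model_gr /span_gr vE.
Qed.

(** On constant functions, translation by [g] is invisible: evaluating there
    maps [C[G]] to [C] by the augmentation. *)
Lemma translate_poly_eval (t : lie_poly F X) :
  poly_eval (H := comm_lie (endo nz))
    (fun x => translate (deg x) (rho x)) t = 0 ->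
  poly_eval (H := comm_lie C) rho t = 0.
Proof.
pose R (T : comm_lie (endo nz)) (c : comm_lie C) :=
  forall v, (T : endo nz) (fun=> v) = fun=> (c : C) * v.
set T := poly_eval _ t => T0; set c := poly_eval _ t.
have : R T c.
  apply: poly_eval_rel.
  - by move=> v; apply: funext => h; rewrite mul0r.
  - move=> a T1 c1 T2 c2 R1 R2 v; apply: funext => h /=.
    by rewrite !fctE R1 R2 mulrDl scalerAl.
  - move=> T1 c1 T2 c2 R1 R2 v; apply: funext => h /=.
    have -> : lie c1 c2 * v = c1 * (c2 * v) - c2 * (c1 * v) :> C.
      by rewrite !mulrA -mulrBl.
    by rewrite !fctE /= R1 R2 R1 R2.
  by move=> x v.
by move=> /(_ 1)/(congr1 (@^~ 1%g)); rewrite T0 /= mulr1.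
Qed.
End VGModel.

(** * Evaluation of Lie polynomials and homomorphisms *)

Section EvaluationMorphisms.
Variables (F : fieldType) (X : Type).
Implicit Types (t : lie_poly F X).

Lemma val_poly_eval (A : algType F) (L : lieSubalg A) (i : X -> lie_sub L) t :
  val (poly_eval i t) = poly_eval (H := comm_lie A) (fun x => val (i x)) t.
Proof.
apply: (poly_eval_rel (H2 := comm_lie A)
  (R := fun (x : lie_sub L) (y : comm_lie A) => val x = y :> A)) => //.
  by move=> c x1 x2 y1 y2 <- <-; rewrite linearP.
by move=> x1 x2 y1 y2 <- <-.
Qed.

Lemma lrmorph_poly_eval (A C : algType F) (f : {lrmorphism A -> C})
    (i : X -> A) t :
  f (poly_eval (H := comm_lie A) i t)
  = poly_eval (H := comm_lie C) (fun x => f (i x)) t.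
Proof.
apply: (poly_eval_rel (H1 := comm_lie A) (H2 := comm_lie C)
  (R := fun (x : A) (y : C) => f x = y)) => //.
- exact: raddf0.
- by move=> c x1 x2 y1 y2 <- <-; rewrite linearP.
move=> x1 x2 y1 y2 <- <-.
by rewrite -[LHS]/(f ((x1 : A) * y1 - y1 * (x1 : A))) rmorphB !rmorphM.
Qed.

Lemma glie_poly_eval (L H : lieAlgType F) (f : {linear L -> H}) (i : X -> L) t :
  (forall x y, f (lie x y) = lie (f x) (f y)) ->
  f (poly_eval i t) = poly_eval (fun x => f (i x)) t.
Proof.
move=> f_lie; apply: (poly_eval_rel (R := fun x y => f x = y)) => //.
- exact: raddf0.
- by move=> c x1 x2 y1 y2 <- <-; rewrite linearP.
by move=> x1 x2 y1 y2 <- <-.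
Qed.

Lemma poly_eval_restrict (H : lieAlgType F) (u : X -> H) (S : pred X) t :
  \sum_(p <- t | all S (letters p.2)) p.1 *: mon_eval u p.2
  = poly_eval (fun x => if S x then u x else 0) t.
Proof.
rewrite big_mkcond; apply: eq_bigr => -[c m] _ /=.
suff -> : mon_eval (fun x => if S x then u x else 0) m
    = if all S (letters m) then mon_eval u m else 0.
  by case: ifP => _ //; rewrite scaler0.
elim: m => [x|a IHa b IHb] /=; first by rewrite andbT.
rewrite IHa IHb all_cat; case: (all S (letters a)) => /=; last by rewrite lie0l.
by case: (all S (letters b)) => //; rewrite linear0.
Qed.

Lemma poly_eval_lie_sub (A : algType F) (L : lieSubalg A) (i : X -> A) t :
  (forall x, i x \in L) -> poly_eval (H := comm_lie A) i t \in L.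
Proof.
move=> iL; have -> : poly_eval (H := comm_lie A) i t
    = val (poly_eval (fun x => LieSub (iL x)) t) by rewrite val_poly_eval.
exact: valP.
Qed.

Lemma lie_gen_poly (A : algType F) (i : X -> A) a :
  a \in lie_gen i -> exists t, a = poly_eval (H := comm_lie A) i t.
Proof.
pose R : {pred A} := fun a =>
  `[< exists t, a = poly_eval (H := comm_lie A) i t >].
have R_submod : submod_closed R.
  split=> [|c x y /asboolP[s ->] /asboolP[t ->]]; apply/asboolP.
    by exists [::]; rewrite poly_eval_nil.
  by exists (poly_scale c s ++ t); rewrite poly_eval_cat poly_eval_scale.
have R_commr : {in R &, forall x y, commr x y \in R}.
  move=> x y /asboolP[s ->] /asboolP[t ->]; apply/asboolP.
  by exists (poly_bracket s t); rewrite poly_eval_bracket.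
move=> /asboolP/(_ (LieSubalg R_submod R_commr)) Ra; apply/asboolP;
  apply: Ra => x.
apply/asboolP; exists [:: (1, Letter x)].
by rewrite poly_eval_cons poly_eval_nil scale1r addr0.
Qed.
End EvaluationMorphisms.

(** * Identities of graded Lie algebras *)

Section Identities.
Variables (G : groupType) (F : fieldType) (X : Type) (deg : X -> G).

(** The property common to the relatively free algebra and to the algebra of a
    free pair that forces the Lie algebra generated by [i] to be free. *)
Definition extends_to_VG (A : algType F) (i : X -> A) : Prop :=
  forall (C : algType F) (C_ : G -> {pred C}), in_VG C_ ->
  forall u : X -> C, respects deg C_ u ->
  exists f : {lrmorphism A -> C}, forall x, f (i x) = u x.

Definition graded_lie_identity (t : lie_poly F X) : Prop :=
  forall (H : lieAlgType F) (H_ : G -> {pred H}), lie_grading H_ ->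
  forall u : X -> H, respects deg H_ u -> poly_eval u t = 0.

(** Restricting [t] to the letters in [S] amounts to evaluating the other letters
    at zero, and such evaluations in [C] lift to [VG_model C], hence factor
    through [A]. *)
Lemma restrict_assoc_identity (A : algType F) (i : X -> A) t (S : pred X) :
  extends_to_VG i -> poly_eval (H := comm_lie A) i t = 0 ->
  (forall x y, S x -> S y -> commute (deg x) (deg y)) ->
  assoc_identity [seq p <- t | all S (letters p.2)].
Proof.
move=> ext t0 Scomm C rho.
rewrite {1}/poly_eval big_filter poly_eval_restrict.
set rhoS := (fun x => if S x then _ else _).
have rhoS0 x : ~~ S x -> (rhoS x : C) = 0 by rewrite /rhoS => /negbTE ->.
have var x := VG_model_var deg rhoS0 x.
have [f fi] := ext _ _ (VG_model_in_VG C Scomm) (fun x => s2val (var x))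
  (fun x => s2valP (var x)).
apply: (translate_poly_eval (deg := deg)).
have ft0 : subalg_incl (f (poly_eval (H := comm_lie A) i t)) = 0.
  by rewrite t0 (rmorph0 f) rmorph0.
rewrite -[RHS]ft0 (lrmorph_poly_eval f) (lrmorph_poly_eval subalg_incl).
apply: eq_poly_eval => x.
by rewrite fi; exact/esym/(s2valP' (var x)).
Qed.

(** Let [S] be the set of letters of the first term. Removing from [t] all terms
    with letters in [S] changes no partial sum: what is removed from the sum
    over [S'] is the sum over the intersection of [S] and [S'], which is zero.
    The list gets shorter, so induction applies. Letters are compared by
    their degrees, which are enough to tell whether they commute. *)
Lemma sum_over_cliques (V : zmodType) (I : Type) (t : seq I) (l : I -> seq X)
    (f : I -> V) :
  (forall S : pred X, (forall x y, S x -> S y -> commute (deg x) (deg y)) ->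
     \sum_(p <- t | all S (l p)) f p = 0) ->
  all (fun p => `[< {in map deg (l p) &, forall g h, commute g h} >]) t ->
  \sum_(p <- t) f p = 0.
Proof.
have [n] := ubnP (size t); elim: n t => // n IHn [|p t] szt f0 tc.
  by rewrite big_nil.
pose S x := deg x \in map deg (l p).
have Scomm x y : S x -> S y -> commute (deg x) (deg y).
  by move: tc => /= /andP[/asboolP pc _]; exact: pc.
have Sp : all S (l p).
  rewrite -[all S _]/(all (preim deg (mem (map deg (l p)))) (l p)) -all_map.
  exact/allP.
rewrite (bigID (fun q => all S (l q))) /= f0 // add0r -big_filter.
apply: IHn => [|S' S'comm|]; last 1 first.
- by rewrite all_filter; apply: sub_all tc => q /= ->; rewrite implybT.
- rewrite /= Sp /=; apply: (@leq_ltn_trans (size t)) => //.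
  by rewrite size_filter count_size.
rewrite big_filter_cond; have := f0 S' S'comm.
rewrite (bigID (fun q => all S (l q))) /=.
rewrite (eq_bigl (fun q => all (predI S S') (l q))) => [|q]; last first.
  by rewrite all_predI andbC.
rewrite f0 => [|x y /andP[_ xS'] /andP[_ yS']]; last exact: S'comm.
by rewrite add0r; under eq_bigl => q do rewrite andbC.
Qed.

Lemma all_mem_map (S : pred X) (l : seq X) g :
  all S l -> g \in map deg l -> exists2 x, S x & g = deg x.
Proof.
elim: l => //= x l IHl /andP[Sx /IHl lS]; rewrite inE => /orP[/eqP ->|//].
by exists x.
Qed.

(** Monomials with two non-commuting letters vanish in [H] by themselves, and the
    sum of the others vanishes because each restriction to a set of commuting
    letters does. *)
Lemma graded_lie_identityP (A : algType F) (i : X -> A) t :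
  extends_to_VG i -> poly_eval (H := comm_lie A) i t = 0 ->
    graded_lie_identity t.
Proof.
move=> ext t0 H H_ gH u uH.
pose cl (p : F * lie_mon X) := `[< commuting_letters deg p.2 >].
rewrite /poly_eval (bigID cl) /=.
rewrite [X in _ + X]big1 => [|p /asboolPn ncl]; last first.
  by rewrite (mon_eval_noncommuting gH uH) // scaler0.
rewrite addr0 -big_filter.
apply: (sum_over_cliques (l := fun p => letters p.2)).
  move=> S Scomm; rewrite big_filter_cond.
  rewrite (eq_bigl (fun p => all S (letters p.2))) => [|[c m] /=].
    rewrite -big_filter; apply: lie_identity_of_assoc;
      exact: restrict_assoc_identity t0 Scomm.
  rewrite andbC; case: (boolP (all S _)) => //= Sm; apply/asboolP => g h /=.
  by move=> /(all_mem_map Sm)[x Sx ->] /(all_mem_map Sm)[y Sy ->]; exact: Scomm.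
exact: filter_all.
Qed.
End Identities.

(** * Freeness of a graded Lie algebra *)

Section FreeLie.
Variables (G : groupType) (F : fieldType) (X : Type) (deg : X -> G).

Lemma poly_eval_component (H : lieAlgType F) (u : X -> H) t g :
  \sum_(p <- t | mon_deg deg p.2 == g) p.1 *: mon_eval u p.2
  = poly_eval u [seq p <- t | mon_deg deg p.2 == g].
Proof. by rewrite /poly_eval big_filter. Qed.

(** A Lie algebra generated by homogeneous elements is a graded subspace: Lie
    monomials in the generators are homogeneous. *)
Lemma generated_lie_grading (A : algType F) (A_ : G -> {pred A})
    (L : lieSubalg A) (i : X -> lie_sub L) :
  direct_decomp A_ -> respects deg (sub_gr A_ (L := L)) i ->
  (forall x : lie_sub L, exists t, x = poly_eval i t) ->
  (forall g h a b, a \in L -> b \in L -> a \in A_ g -> b \in A_ h ->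
     commr a b \in A_ (g * h)%g) ->
  lie_grading (sub_gr A_ (L := L)).
Proof.
move=> dA iA gen brA; have [A_submod A_sum A_indep] := dA.
have br g h (x y : lie_sub L) : x \in sub_gr A_ (L := L) g ->
    y \in sub_gr A_ (L := L) h -> lie x y \in sub_gr A_ (L := L) (g * h)%g.
  by move=> xg yh; apply: brA; [exact: valP|exact: valP|exact: xg|exact: yh].
have L_submod g : submod_closed (sub_gr A_ (L := L) g).
  have [z cl] := A_submod g; split; first by rewrite unfold_in /sub_gr raddf0.
  by move=> c x y xg yg; rewrite unfold_in /sub_gr linearP; exact: cl.
split; last exact: br.
split=> // [x|s w us ws w0 g gs]; last first.
  apply: val_inj; rewrite raddf0; apply: (A_indep s (val \o w)) gs => //.
  by rewrite -raddf_sum w0 raddf0.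
have [t ->] := gen x.
rewrite /poly_eval (sum_by_degree t (fun p => mon_deg deg p.2)).
eexists _, _; split; last by reflexivity.
move=> g; have [z cl] := L_submod g.
apply: (big_ind (fun y => y \in sub_gr A_ (L := L) g))
  => // [a b ag bg|p /eqP <-].
  by rewrite -[a]scale1r; exact: cl.
have {z cl}[z cl] := L_submod (mon_deg deg p.2).
rewrite -[_ *: _]addr0; apply: cl => //.
by elim: p.2 => [y|a IHa b IHb] /=; [exact: iA | exact: br].
Qed.

(** The homomorphism to [H] sends the value of a Lie polynomial in [L] to its
    value in [H]. It preserves degrees because the component of degree [h] of
    a Lie polynomial with homogeneous value of degree [g] is, for [h != g], zero
    in [L], hence an identity. *)
Lemma free_glie_of_identities (L : lieAlgType F) (L_ : G -> {pred L})
    (i : X -> L) :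
  lie_grading L_ -> injective i -> respects deg L_ i ->
  (forall x, exists t, x = poly_eval i t) ->
  (forall t, poly_eval i t = 0 -> graded_lie_identity deg t) ->
  free_glie deg L_ i.
Proof.
move=> gL inj_i iL gen ident; split=> // H H_ gH u uH.
have ident_eq s t : poly_eval i s = poly_eval i t ->
  poly_eval u s = poly_eval u t.
  move=> st; apply/eqP; rewrite -subr_eq0 -scaleN1r -poly_eval_scale
    -poly_eval_cat.
  apply/eqP; apply: ident gH _ uH.
  by rewrite poly_eval_cat poly_eval_scale st scaleN1r subrr.
have /choice[r rE] : forall x, exists t, poly_eval i t = x.
  by move=> x; have [t ->] := gen x; exists t.
pose f x := poly_eval u (r x).
have f_eval t : f (poly_eval i t) = poly_eval u t.
  by apply: ident_eq; rewrite rE.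
have f_linear : linear f.
  move=> c x y; rewrite -{1}[x]rE -{1}[y]rE -poly_eval_scale -poly_eval_cat
    f_eval.
  by rewrite poly_eval_cat poly_eval_scale.
pose fL : {linear L -> H} :=
  HB.pack f (GRing.isLinear.Build F L H *:%R f f_linear).
exists fL; last first.
  move=> f' [[f'_lie _] f'i] x;
    rewrite -[x]rE /= f_eval (glie_poly_eval _ _ f'_lie).
  exact: eq_poly_eval.
split; last first.
  move=> x /=; have -> : i x = poly_eval i [:: (1, Letter x)].
    by rewrite poly_eval_cons poly_eval_nil scale1r addr0.
  by rewrite f_eval poly_eval_cons poly_eval_nil scale1r addr0.
split=> [x y /=|g x xg /=].
  by rewrite -[x]rE -[y]rE -poly_eval_bracket !f_eval poly_eval_bracket.
have [t xt] := gen x; rewrite xt f_eval /poly_eval.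
rewrite (sum_by_degree t (fun p => mon_deg deg p.2)) big_seq.
apply: (decomp_sum gH.1) => h hs.
have [<-|hg] := eqVneq h g.
  apply: (decomp_sum gH.1) => p /eqP <-.
  by apply: (decompZ gH.1); exact: mon_eval_deg.
rewrite poly_eval_component (ident _ _ _ _ gH _ uH) ?(decomp0 gH.1) //.
rewrite -poly_eval_component.
move: xt; rewrite /poly_eval (sum_by_degree t (fun p => mon_deg deg p.2)).
move/(decomp_homogeneous gL.1 xg (undup_uniq _)) => -> // k.
apply: (decomp_sum gL.1) => p /eqP <-.
by apply: (decompZ gL.1); exact: mon_eval_deg.
Qed.
End FreeLie.

(** * Pairs and the two varieties *)

Section Pairs.
Variables (G : groupType) (F : fieldType).

(** The product [x y] lies in the component [g h] and, being [y x] up to a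
    commutator, in the component [h g]. *)
Lemma noncommuting_mul0 (A : algType F) (A_ : G -> {pred A}) g h x y :
  alg_grading A_ -> x \in A_ g -> y \in A_ h -> commr y x \in A_ (h * g)%g ->
  [~ g, h]%g != 1%g -> x * y = 0.
Proof.
move=> [dA mulA] xg yh yx gh.
apply: (decomp_disjoint dA (g := g * h) (h := h * g))%g; last 1 first.
- have -> : x * y = (-1) *: commr y x + y * x by rewrite scaleN1r opprB subrK.
  by apply: (decompZD dA) => //; exact: mulA.
- by apply: contra gh => /eqP ghC; apply/commgP.
exact: mulA.
Qed.

Lemma gpair_in_WG (A : algType F) (A_ : G -> {pred A}) (L : lieSubalg A) :
  gpair A_ L -> in_WG A_ L.
Proof.
move=> gp; split=> // g h x y gh xg yh; have [gA gL] := gp.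
exact: (noncommuting_mul0 gA xg yh (gL.2 _ _ _ _ yh xg)).
Qed.

Lemma strong_gpair_in_VG (A : algType F) (A_ : G -> {pred A})
    (L : lieSubalg A) :
  strong_gpair A_ L -> in_VG A_.
Proof.
move=> [[gA _] brA]; split=> // g h a b gh ag bh.
exact: (noncommuting_mul0 gA ag bh (brA _ _ _ _ bh ag)).
Qed.

Lemma in_VG_commr (A : algType F) (A_ : G -> {pred A}) g h a b :
  in_VG A_ -> a \in A_ g -> b \in A_ h -> commr a b \in A_ (g * h)%g.
Proof.
move=> [gA A0] ag bh; rewrite /commr.
have [/eqP/commgP gh|gh] := eqVneq [~ g, h]%g 1%g.
  rewrite addrC -scaleN1r; apply: (decompZD gA.1); last exact: gA.2.
  by rewrite [(g * h)%g]gh; exact: gA.2.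
rewrite (A0 _ _ _ _ gh ag bh) (A0 h g) ?subrr ?(decomp0 gA.1) //.
by rewrite commg1_sym.
Qed.

Lemma in_VG_full (A : algType F) (A_ : G -> {pred A}) :
  in_VG A_ -> in_WG A_ (full_lie A).
Proof.
move=> vA; apply: gpair_in_WG; have [[dA mulA] _] := vA; split=> //.
have [A_submod A_sum A_indep] := dA.
pose up (a : A) : lie_sub (full_lie A) := LieSub (isT : a \in full_lie A).
split; last by move=> g h x y; exact: in_VG_commr.
split=> [g|x|s w us ws w0 g gs].
- have [z cl] := A_submod g; split; first by rewrite unfold_in /sub_gr raddf0.
  by move=> c x y xg yg; rewrite unfold_in /sub_gr linearP; exact: cl.
- have [s [w [ws xE]]] := A_sum (val x).
  by exists s, (up \o w); split=> //; apply: val_inj; rewrite raddf_sum.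
apply: val_inj; rewrite raddf0; apply: (A_indep s (val \o w)) gs => //.
by rewrite -raddf_sum w0 raddf0.
Qed.

(** Multiplication by the degree-one part of [1] fixes every homogeneous element,
    by comparison of components in [1 * x = x]; so that part is [1]. *)
Lemma grading_one (A : algType F) (A_ : G -> {pred A}) :
  alg_grading A_ -> 1 \in A_ 1%g.
Proof.
move=> [dA mulA]; have [A_submod A_sum A_indep] := dA.
have [s0 [w0 [w0s oneE]]] := A_sum 1.
pose s := undup [seq g | g <- s0]; pose w g := \sum_(h <- s0 | h == g) w0 h.
have ws g : w g \in A_ g.
  by apply: (decomp_sum dA) => h /eqP <-.
have {oneE} oneE : 1 = \sum_(g <- s) w g by rewrite oneE (sum_by_degree s0 id).
have homog x h : x \in A_ h -> forall g, g \in s -> g != 1%g -> w g * x = 0.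
  move=> xh g gs g1.
  have := decomp_homogeneous dA xh (s := [seq (k * h)%g | k <- s])
    (w := fun k => w (k * h^-1)%g * x).
  rewrite map_inj_uniq ?undup_uniq; last exact: mulIg.
  move=> /(_ isT) D; have := D _ _ (g * h)%g; rewrite mulgK; apply.
  - by move=> k; rewrite -{2}[k](mulgVK h) mulA.
  - rewrite big_map; under eq_bigr => k _ do rewrite mulgK.
    by rewrite -mulr_suml -oneE mul1r.
  - exact: map_f.
  by rewrite -{2}[h]mul1g (inj_eq (mulIg h)).
have [s1|s1] := boolP (1%g \in s).
  suff -> : 1 = w 1%g by [].
  have e1 x h : x \in A_ h -> x = w 1%g * x.
    move=> xh; rewrite -{1}[x]mul1r oneE mulr_suml (bigD1_seq 1%g)
      ?undup_uniq //=.
    rewrite big_seq_cond big1 ?addr0 // => g /andP[gs g1].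
    exact: homog xh _ gs g1.
  rewrite -[w 1%g]mulr1 oneE mulr_sumr.
  by apply: eq_bigr => g _; exact: e1 (ws g).
suff : 1 = 0 :> A by move/eqP; rewrite oner_eq0.
rewrite {1}oneE big_seq big1 // => g gs.
rewrite -[w g]mul1r oneE mulr_suml big_seq big1 // => h hs.
by apply: (homog _ g) => //; apply: contraNneq s1 => <-.
Qed.
End Pairs.

(** * The relatively free algebra and the free pair *)

Section Generators.
Variables (G : groupType) (F : fieldType) (X : Type) (deg : X -> G).

Lemma lie_gen_poly_in (A : algType F) (i : X -> A) (x : lie_sub (lie_gen i)) :
  exists t, x = poly_eval (lie_gen_in i) t.
Proof.
have [t xt] := lie_gen_poly (valP x); exists t; apply: val_inj.
by rewrite val_poly_eval.
Qed.

(** A homomorphism of algebras extends a homomorphism of Lie algebras as soon as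
    the two agree on generators. *)
Lemma lie_sub_ext_poly (A C : algType F) (L : lieSubalg A) (H : lieSubalg C)
    (i : X -> lie_sub L) (f : {lrmorphism A -> C})
    (phi : {linear lie_sub L -> lie_sub H}) :
  (forall x : lie_sub L, exists t, x = poly_eval i t) ->
  (forall x y, phi (lie x y) = lie (phi x) (phi y)) ->
  (forall x, f (val (i x)) = val (phi (i x))) ->
  forall x, f (val x) = val (phi x).
Proof.
move=> gen phi_lie fi x; have [t ->] := gen x.
rewrite (glie_poly_eval i t phi_lie) !val_poly_eval lrmorph_poly_eval.
exact: (eq_poly_eval (H := comm_lie C)).
Qed.

Section RelativelyFree.
Variables (A : algType F) (A_ : G -> {pred A}) (i : X -> A).
Hypothesis freeA : relfree_VG deg A_ i.

Lemma relfree_VG_extends : extends_to_VG deg i.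
Proof.
move=> C C_ vC u uC; have [_ _ _ _ univ] := freeA.
by have [f [_ fi] _] := univ C C_ vC u uC; exists f.
Qed.

Lemma relfree_gen_grading : lie_grading (sub_gr A_ (L := lie_gen i)).
Proof.
have [vA _ iA _ _] := freeA; have [[dA _] _] := vA.
apply: (generated_lie_grading (deg := deg) dA (i := lie_gen_in i)) => //;
  first exact: lie_gen_poly_in.
by move=> g h a b _ _; exact: in_VG_commr.
Qed.

Lemma relfree_free_glie :
  free_glie deg (sub_gr A_ (L := lie_gen i)) (lie_gen_in i).
Proof.
have [_ inj_i iA _ _] := freeA.
apply: free_glie_of_identities => //.
- exact: relfree_gen_grading.
- by move=> x y /(congr1 val) /inj_i.
- exact: lie_gen_poly_in.
move=> t t0; apply: graded_lie_identityP relfree_VG_extends _.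
by rewrite -(val_poly_eval (lie_gen_in i)) t0 raddf0.
Qed.

Lemma relfree_is_SUG : is_SUG A_ (lie_gen i).
Proof.
have [vA _ iA _ univ] := freeA; have [gA _] := vA.
split; first by split; [split=> //; exact: relfree_gen_grading | move=> *;
  exact: in_VG_commr].
move=> C C_ H sC phi [phi_lie phi_gr].
have [|f [f_gr fi] f_uniq] := univ C C_ (strong_gpair_in_VG sC)
  (fun x => val (phi (lie_gen_in i x))).
  by move=> x; apply: phi_gr; exact: iA.
exists f.
  split=> //; apply: lie_sub_ext_poly phi_lie _ => [x|x];
    first exact: lie_gen_poly_in.
  exact: fi.
move=> f' [f'_gr f'_val]; apply: f_uniq; split=> // x.
exact: (f'_val (lie_gen_in i x)).
Qed.
End RelativelyFree.

Section FreePair.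
Variables (A : algType F) (A_ : G -> {pred A}) (L : lieSubalg A).
Variable j : X -> lie_sub L.
Hypothesis freeL : free_WG deg A_ j.
Let gp : gpair A_ L. Proof. by case: freeL => [[]]. Qed.
Let jA : respects deg A_ (fun x => val (j x)). Proof. by case: freeL. Qed.

Lemma pair_commr g h a b : a \in L -> b \in L -> a \in A_ g -> b \in A_ h ->
  commr a b \in A_ (g * h)%g.
Proof. by move=> aL bL ag bh; exact: (gp.2.2 g h (LieSub aL) (LieSub bL)). Qed.

(** The uniqueness in the universal property, for maps to the pair itself. *)
Lemma free_WG_endo (f : {lrmorphism A -> A}) :
  pair_hom A_ A_ L L f -> (forall x, f (val (j x)) = val (j x)) -> f =1 id.
Proof.
move=> f_hom fj; have [wA _ jL univ] := freeL.
have [f0 _ uniq0] := univ A A_ L wA j jL.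
move=> a; rewrite (uniq0 f (conj f_hom fj)).
have id_hom : pair_hom A_ A_ L L (idfun : {lrmorphism A -> A}) by split.
by rewrite -(uniq0 (idfun : {lrmorphism A -> A}) (conj id_hom (fun=> erefl))).
Qed.

Lemma lie_gen_sub a : a \in lie_gen (fun x => val (j x)) -> a \in L.
Proof.
by move/lie_gen_poly => [t ->]; apply: poly_eval_lie_sub => x; exact: valP.
Qed.

(** The pair ([lie_gen], [A]) is in W_G, so there is a homomorphism from
    ([L], [A]) to it over the variables; as an endomorphism of [A] it is the
    identity, so it maps [L] into [lie_gen] only if [L] is contained in it. *)
Lemma free_WG_lie_gen : lie_gen (fun x => val (j x)) =i L.
Proof.
move=> a; apply/idP/idP; first exact: lie_gen_sub.
set i := fun x => val (j x) => aL; have [_ _ _ univ] := freeL.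
have gpi : gpair A_ (lie_gen i).
  split; first exact: gp.1.
  apply: (generated_lie_grading (deg := deg) gp.1.1 (i := lie_gen_in i)) => //.
    exact: lie_gen_poly_in.
  by move=> g h x y /lie_gen_sub xL /lie_gen_sub yL; exact: pair_commr.
have [f [[f_gr fL] fj] _] :=
  univ A A_ (lie_gen i) (gpair_in_WG gpi) (lie_gen_in i) jA.
have f_id : f =1 id.
  by apply: free_WG_endo => //; split=> // b /fL; exact: lie_gen_sub.
by rewrite -[a]f_id; exact: fL.
Qed.

Lemma free_WG_poly (x : lie_sub L) : exists t, x = poly_eval j t.
Proof.
have := valP x; rewrite -free_WG_lie_gen => /lie_gen_poly[t xt].
by exists t; apply: val_inj; rewrite val_poly_eval.
Qed.

Lemma free_WG_extends : extends_to_VG deg (fun x => val (j x)).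
Proof.
move=> C C_ vC u uC; have [_ _ _ univ] := freeL.
pose up x : lie_sub (full_lie C) := LieSub (isT : u x \in full_lie C).
by have [f [_ fi] _] := univ C C_ _ (in_VG_full vC) up uC; exists f.
Qed.

Lemma free_WG_free_glie : free_glie deg (sub_gr A_ (L := L)) j.
Proof.
have [_ inj_j jL _] := freeL; apply: free_glie_of_identities => //.
- exact: gp.2.
- exact: free_WG_poly.
move=> t t0; apply: graded_lie_identityP free_WG_extends _.
by rewrite -(val_poly_eval j) t0 raddf0.
Qed.

(** Let [B] be a subalgebra containing [L]. The sums of homogeneous elements of [B]
    form a graded algebra [C], to which the universal property applies; the
    composite [A -> C -> A] fixes the variables, so it is the identity, and its
    image is contained in [B]. *)
Lemma free_WG_generated : alg_generated (fun a => a \in L).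
Proof.
move=> B clB LB a; have [[dA mulA] gL] := gp; have [_ _ _ univ] := freeL.
have [A_submod _ A_indep] := dA; have [B1 BZD BM] := clB.
pose E_ (g : G) : {pred A} := fun a => (a \in A_ g) && (a \in B).
have E_submod g : submod_closed (E_ g).
  have [z cl] := A_submod g; have [zB clB'] := GRing.subalg_closedZ clB.
  split; first by rewrite unfold_in /E_ z zB.
  by move=> c x y /andP[xg xB] /andP[yg yB]; rewrite unfold_in /E_ cl ?clB'.
have E_one : 1 \in E_ 1%g by rewrite unfold_in /E_ B1 grading_one.
have E_mul g h x y : x \in E_ g -> y \in E_ h -> x * y \in E_ (g * h)%g.
  by move=> /andP[xg xB] /andP[yg yB]; rewrite unfold_in /E_ mulA ?BM.
have E_indep (s : seq G) (w : G -> A) : uniq s -> (forall g, w g \in E_ g) ->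
    \sum_(g <- s) w g = 0 -> forall g, g \in s -> w g = 0.
  by move=> us wE; apply: A_indep => // g; case/andP: (wE g).
pose C := span_alg E_submod E_one E_mul.
pose C_ := @span_gr G F A E_ E_submod E_one E_mul.
have gC : alg_grading C_ by exact: span_alg_grading.
have C_A g (c : C) : c \in C_ g -> subalg_incl c \in A_ g by case/andP.
have var x : {c : C | c \in C_ (deg x) & subalg_incl c = val (j x)}.
  have jE : val (j x) \in E_ (deg x).
    by rewrite unfold_in /E_ jA LB ?(valP (j x)).
  have [c cj] := span_algP E_submod E_one E_mul (graded_span_homogeneous jE).
  by exists c => //; rewrite unfold_in /C_ /span_gr cj.
pose k x : C := s2val (var x).
have kE x : subalg_incl (k x) = val (j x) := s2valP' (var x).
have kL c : c \in lie_gen k -> subalg_incl c \in L.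
  move=> /lie_gen_poly[t ->]; rewrite (lrmorph_poly_eval subalg_incl).
  by apply: poly_eval_lie_sub => x; have := valP (j x); rewrite -kE.
have kC : respects deg (sub_gr C_ (L := lie_gen k)) (lie_gen_in k).
  by move=> x; exact: (s2valP (var x)).
have gpC : gpair C_ (lie_gen k).
  split=> //; apply: (generated_lie_grading gC.1 kC).
    exact: lie_gen_poly_in.
  move=> g h x y xL yL xg yh; apply/andP; split.
    have -> : subalg_incl (commr x y) = commr (subalg_incl x) (subalg_incl y).
      by rewrite /commr rmorphB !rmorphM.
    by apply: pair_commr; rewrite ?kL ?C_A.
  case/andP: xg => _ xB; case/andP: yh => _ yB.
  have [_ clB'] := GRing.subalg_closedBM clB.
  by rewrite /commr rmorphB !rmorphM clB' ?BM.
have [f [[f_gr fL] fj] _] :=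
  univ C C_ (lie_gen k) (gpair_in_WG gpC) (lie_gen_in k) kC.
have f_id : subalg_incl \o f =1 id.
  apply: free_WG_endo => [|x]; last by rewrite /= fj; exact: kE.
  by split=> [g b /f_gr /C_A|b /fL /kL].
have /asboolP[l lE faE] := subalg_valP (f a).
have -> : a = \sum_(p <- l) p.2 by rewrite -faE; exact/esym/f_id.
have [zB clB'] := GRing.subalg_closedZ clB.
rewrite big_seq.
apply: (big_ind (fun b => b \in B)) => // [b c bB cB|p /lE /andP[] //].
by rewrite -[b]scale1r; exact: clB'.
Qed.

Lemma free_WG_is_UG : is_UG A_ L.
Proof.
split=> //; first exact: free_WG_generated.
move=> C C_ H gC phi [phi_lie phi_gr]; have [_ _ jL univ] := freeL.
have [|f [[f_gr fL] fj] _] := univ C C_ H (gpair_in_WG gC) (fun x => phi (j x)).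
  by move=> x; apply: phi_gr; exact: jL.
exists f; split=> //; apply: lie_sub_ext_poly phi_lie fj.
exact: free_WG_poly.
Qed.
End FreePair.
End Generators.

Theorem corollary23 (G : groupType) (F : fieldType)
    (X : Type) (deg : X -> G)
    (FG : algType F) (FG_ : G -> {pred FG}) (i : X -> FG)
    (A : algType F) (A_ : G -> {pred A}) (L : lieSubalg A)
    (j : X -> lie_sub L) :
  relfree_VG deg FG_ i ->
  free_WG deg A_ j ->
  (free_glie deg (sub_gr FG_ (L := lie_gen i)) (lie_gen_in i)
   /\ is_SUG FG_ (lie_gen i))
  /\
  [/\ lie_gen (fun x => val (j x)) =i L,
      free_glie deg (sub_gr A_ (L := L)) j
    & is_UG A_ L].
Proof.
move=> freeFG freeA; split; split.
- exact: relfree_free_glie freeFG.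
- exact: relfree_is_SUG freeFG.
- exact: free_WG_lie_gen freeA.
- exact: free_WG_free_glie freeA.
- exact: free_WG_is_UG freeA.
Qed.
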